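(* There is an absolute constant $c_0>0$ such that for every prime $q$ and every $r\in(1/2,1)$ there exists $k_0$ (depending on $q$ and $r$) with the following property. Let $k\ge k_0$ be an integer such that $k+1$ is prime, $q$ is a primitive root modulo $k+1$, and $(\frac1r-1)k$ is an integer. Let $d$ be the largest prime strictly smaller than $\sqrt{k}$, let $A$ be a Bose–Chowla Sidon set of order $d$, and let $\alpha^*=\sum_{a\in A}x^a\in\mathbb{F}_{q^k}\subseteq R$. Then there is a real number $c(k)\ge c_0\left(1-\sqrt{2-\frac1r}\right)\sqrt{k}$ such that for every nonzero $y\in R$ with $\widetilde{\mathrm{wt}}(y)\le c(k)$, $$c(k)-\widetilde{\mathrm{wt}}(y)\ \le\ \mathrm{wt}_r(\alpha^*y)\ \le\ \Big(\frac1r-1\Big)k-\big(c(k)-\widetilde{\mathrm{wt}}(y)\big),$$ where the product $\alpha^*y$ is taken in $R$. Consequently, the punctured code $C^{\alpha^*,r}_{\mathrm{WE}}$ has minimum distance at least $c_0\left(1-\sqrt{2-\frac1r}\right)\sqrt{k}$.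
   Context: Representation of $\mathbb{F}_{q^k}$: put $k'=k+1$ and $p(x)=1+x+x^2+\cdots+x^{k'-1}\in\mathbb{F}_q[x]$. Since $k'$ is prime and $q$ is a primitive root modulo $k'$, $p$ is irreducible over $\mathbb{F}_q$, and $\mathbb{F}_{q^k}$ is represented as $\mathbb{F}_q[x]/(p(x))$, i.e. as polynomials in $x$ of degree less than $k$ with operations modulo $p(x)$. Let $\varphi:\mathbb{F}_{q^k}\to\mathbb{F}_q^k$ be the coefficient map $\varphi(\sum_{i=0}^{k-1}a_ix^i)=(a_0,\dots,a_{k-1})$. Codes: for $\alpha\in\mathbb{F}_{q^k}$, the Wozencraft ensemble code is $C^{\alpha}_{\mathrm{WE}}=\{(\varphi(y),\varphi(\alpha y)) : y\in\mathbb{F}_{q^k}\}\subseteq\mathbb{F}_q^{2k}$ (product in $\mathbb{F}_{q^k}$). For $r\in(1/2,1)$ with $(\frac1r-1)k\in\mathbb{Z}$, the punctured code $C^{\alpha,r}_{\mathrm{WE}}$ is obtained by removing the last $(2-\frac1r)k$ coordinates of each codeword of $C^{\alpha}_{\mathrm{WE}}$; it has length $k/r$ and rate $r$. Minimum distance means minimum Hamming distance. Ring $R$ and weights: $R=\mathbb{F}_q[x]/(x^{k'}-1)$, whose elements are represented by polynomials of degree less than $k'$; $\mathbb{F}_{q^k}$ is embedded in $R$ as the $\mathbb{F}_q$-vector space of polynomials of degree less than $k$. For $f\in R$, $\widetilde{\mathrm{wt}}(f)$ is the number of nonzero coefficients of the representative of $f$ of degree less than $k'$. For a polynomial $f$,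 $\mathrm{wt}_r(f)$ is the number of nonzero coefficients among the coefficients of $x^0,x^1,\dots,x^{(\frac1r-1)k-1}$ (the first $(\frac1r-1)k$ least significant coefficients); for $f\in R$ this is applied to the representative of degree less than $k'$. Bose–Chowla Sidon set of order $d$ ($d$ prime): for a primitive element $\theta$ of $\mathbb{F}_{d^2}$ (a generator of $\mathbb{F}_{d^2}^*$), the set $A=\{a\in\mathbb{Z} : 1\le a<d^2,\ \theta^a-\theta\in\mathbb{F}_d\}$. It is a known theorem (Bose–Chowla) that $A$ has exactly $d$ elements and is a Sidon set modulo $d^2-1$, meaning: for $a,b,a',b'\in A$ with $a\ne b$ and $a'\neq b'$, $a-b\equiv a'-b'\pmod{d^2-1}$ if and only if $a=a'$ and $b=b'$. *)

(* Defs.v *)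
From mathcomp Require Import all_boot all_order all_algebra all_fingroup.
From mathcomp Require Import all_solvable all_field.
From mathcomp Require Import reals.
Set Implicit Arguments.
Unset Strict Implicit.
Unset Printing Implicit Defensive.
Import Order.TTheory GRing.Theory Num.Theory.
Local Open Scope ring_scope.

Definition primitive_root_mod (m g : nat) : Prop :=
  coprime g m /\
  forall a : nat, coprime a m -> exists i : nat, a = g ^ i %[mod m].

Definition hamming (F : eqType) (n : nat) (u v : 'rV[F]_n) : nat :=
  #|[set i | u 0 i != v 0 i]|.

(* All distances are at most n, so the default value n of the iterated minimum
   is irrelevant as soon as C has two distinct words. *)
Definition min_dist (F : finType) (n : nat) (C : {set 'rV[F]_n}) : nat :=
  \big[minn/n]_(uv in setX C C | uv.1 != uv.2) hamming uv.1 uv.2.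

(* The last s coordinates are removed. *)
Definition puncture (F : Type) (n s : nat) (w : 'rV[F]_n) : 'rV[F]_(n - s) :=
  \row_(i < n - s) w 0 (widen_ord (leq_subr s n) i).

Definition all_one_poly (q k : nat) : {poly 'F_q} := \sum_(i < k.+1) 'X^i.

Definition cyc_poly (q k : nat) : {poly 'F_q} := 'X^(k.+1) - 1.

(* Elements of [{poly %/ h}] are the polynomials of degree less than deg h,
   multiplied modulo h; they coerce to polynomials.  The library replaces h by
   'X when h is not monic of positive degree, which the two lemmas below rule
   out.  The product of F_(q^k) is that of the ring [Fqk q k]; no proof of
   irreducibility is needed to form it. *)
Notation Fqk q k := {poly %/ all_one_poly q k}.
Notation cyc_ring q k := {poly %/ cyc_poly q k}.

Lemma mk_monic_all_one_poly (q k : nat) :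
  (0 < k)%N -> mk_monic (all_one_poly q k) = all_one_poly q k.
Proof.
move=> k_gt0; have -> : all_one_poly q k = \poly_(i < k.+1) 1.
  by rewrite poly_def; apply: eq_bigr => i _; rewrite scale1r.
rewrite /mk_monic size_poly_eq ?oner_eq0 // ltnS k_gt0 /=.
by rewrite monicE lead_coef_poly ?oner_eq0 // eqxx.
Qed.

Lemma mk_monic_cyc_poly (q k : nat) : mk_monic (cyc_poly q k) = cyc_poly q k.
Proof. by rewrite /mk_monic size_XnsubC // monicXnsubC. Qed.

(* The inclusion of the polynomials of degree less than k into those of degree
   less than k + 1; it is F_q-linear, but not multiplicative. *)
Definition embed (q k : nat) (f : Fqk q k) : cyc_ring q k :=
  in_qpoly (cyc_poly q k) (f : {poly 'F_q}).

Definition coef_map (q k : nat) (f : Fqk q k) : 'rV['F_q]_k :=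
  \row_(i < k) (f : {poly 'F_q})`_i.

Definition code_WE (q k : nat) (alpha : Fqk q k) : {set 'rV['F_q]_(k + k)} :=
  [set row_mx (coef_map y) (coef_map (alpha * y)) | y : Fqk q k].

(* Here and in [wt_low], [Num.truncn] only converts to [nat] a real number
   which is a nonnegative integer when 1/2 < r < 1 and (1/r - 1) k is an
   integer. *)
Definition punctured_code_WE (R : realType) (r : R) (q k : nat)
    (alpha : Fqk q k) :=
  puncture (Num.truncn ((2 - r^-1) * k%:R)) @: code_WE alpha.

Definition wt_cyc (q k : nat) (f : cyc_ring q k) : nat :=
  #|[set i : 'I_k.+1 | (f : {poly 'F_q})`_i != 0]|.

Definition wt_low (R : realType) (r : R) (q k : nat) (f : {poly 'F_q}) : nat :=
  #|[set i : 'I_(Num.truncn ((r^-1 - 1) * k%:R)) | f`_i != 0]|.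

(* When d is prime and #|K| = d ^ 2, the elements [c%:R], for [c : 'F_d], form
   the subfield F_d of K. *)
Definition bose_chowla (d : nat) (K : finFieldType) (theta : {unit K}) :
    {set 'I_(d ^ 2)} :=
  [set a : 'I_(d ^ 2) | (1 <= a)%N
     && (val theta ^+ a - val theta \in codom (fun c : 'F_d => c%:R : K))].

Definition alpha_star (q k n : nat) (A : {set 'I_n}) : Fqk q k :=
  \sum_(a in A) 'qX ^+ a.

(* Main.v *)
Require Import Defs.
From mathcomp Require Import all_boot all_order all_algebra all_fingroup.
From mathcomp Require Import all_solvable all_field.
From mathcomp Require Import reals.
From mathcomp Require Import boolp sequences exp.
From mathcomp Require Import ring lra zify.
Import Order.TTheory GRing.Theory Num.Theory.
Local Open Scope ring_scope.

Set Implicit Arguments.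
Unset Strict Implicit.
Unset Printing Implicit Defensive.

(** Write s = sqrt (2 - 1/r).  The product alpha* y is a combination of cyclic
    shifts of A, one for each nonzero coefficient of y.  By the Sidon property
    two shifts meet in at most two points, and by the Erdos-Turan bound at most
    about s sqrt k points of a shift fall outside the window of the first
    (1/r - 1) k coordinates.  As A has d elements, about (1 - s) sqrt k points
    of one fixed shift stay inside, provided that d is asymptotic to sqrt k,
    and each further coefficient of y cancels at most two of them.  For the
    code, passing from F_q[x]/(x^(k+1) - 1) to F_(q^k) subtracts the top
    coefficient from all the others; if it is nonzero the zeros of the product
    are counted instead of its nonzero coefficients.

    That d is asymptotic to sqrt k means that (x, c x] contains a prime for
    every c > 1 and x large, which is proved by the elementary argument of
    Selberg and Erdos.  Selberg's formula bounds the density of the primes near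
    any x by 2.  If intervals (x, a x] are almost free of primes while (x, b x]
    never is, with b slightly above a, the formula forces density 2 on
    (x/p, a x/p] for most primes p <= x; as such p occur in every (y, b y],
    these intervals cover long ranges almost completely, so that the density is
    at least 3/2 there, against Chebyshev's bound. *)

(** * The von Mangoldt and Moebius functions *)

Section ArithmeticFunctions.
Context {R : realType}.
Implicit Types n m k d p N : nat.

Lemma sum_multiples (f : nat -> R) n N : (0 < n)%N ->
  \sum_(1 <= k < N.+1 | (n %| k)%N) f k =
  \sum_(1 <= m < (N %/ n).+1) f (n * m)%N.
Proof.
move=> n0; elim: N => [|N IH]; first by rewrite div0n !big_geq.
rewrite big_mkcond big_nat_recr //= -big_mkcond /= IH divnS //.
case: ifP => [dv|_]; last by rewrite add0n addr0.
rewrite add1n [RHS]big_nat_recr //=; congr (_ + f _).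
have /divnK : (n %| N.+1)%N by [].
by rewrite divnS // dv add1n mulnC => ->.
Qed.

Lemma sum_hyperbola (f : nat -> nat -> R) N :
  \sum_(1 <= n < N.+1) \sum_(1 <= m < (N %/ n).+1) f n (n * m)%N =
  \sum_(1 <= k < N.+1) \sum_(1 <= n < N.+1 | (n %| k)%N) f n k.
Proof.
rewrite (exchange_big_dep xpredT) //=.
rewrite big_nat_cond [RHS]big_nat_cond; apply: eq_bigr => n.
by rewrite andbT => /andP[n0 _]; rewrite (sum_multiples _ _ n0).
Qed.

(** By unique factorization at most one pair (p, k) has p^k = n. The double sum avoids choosing it
    and can be exchanged directly with sums over n. *)
Definition vonMangoldt n : R :=
  \sum_(1 <= p < n.+1 | prime p) \sum_(1 <= k < n.+1 | (p ^ k == n)%N) ln p%:R.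

Lemma vonMangoldtE n N : (n <= N)%N ->
  vonMangoldt n =
  \sum_(1 <= p < N.+1 | prime p) \sum_(1 <= k < N.+1 | (p ^ k == n)%N) ln p%:R.
Proof.
move=> nN; have nN1 : (n.+1 <= N.+1)%N by [].
rewrite /vonMangoldt [RHS](big_cat_nat_idem _ (n := n.+1)) //=; last exact: addr0.
rewrite [X in _ = _ + X]big_nat_cond [X in _ = _ + X]big1 ?addr0; last first.
  move=> p /andP[/andP[np _] pp]; rewrite big_nat_cond big1 // => k.
  move=> /andP[/andP[k0 _] /eqP e]; move: np; rewrite -e ltnNge.
  by rewrite -{1}(expn1 p) leq_exp2l ?prime_gt1 ?k0.
apply: eq_bigr => p pp.
rewrite [RHS](big_cat_nat_idem _ (n := n.+1)) //=; last exact: addr0.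
rewrite [X in _ = _ + X]big_nat_cond [X in _ = _ + X]big1 ?addr0 // => k.
move=> /andP[/andP[nk _] /eqP e]; move: nk; rewrite -e ltnNge.
by rewrite ltnW // ltn_expl ?prime_gt1.
Qed.

Lemma vonMangoldt_ge0 n : 0 <= vonMangoldt n.
Proof.
apply: sumr_ge0 => p pp; apply: sumr_ge0 => k _.
by rewrite ln_ge0 // ler1n prime_gt0.
Qed.

Lemma ln_prod (I : Type) (s : seq I) (P : pred I) (f : I -> R) :
  (forall i, P i -> 0 < f i) ->
  ln (\prod_(i <- s | P i) f i) = \sum_(i <- s | P i) ln (f i).
Proof.
move=> f0; elim: s => [|i s IH]; first by rewrite !big_nil ln1.
rewrite !big_cons; case: ifP => // Pi.
by rewrite lnM ?IH // posrE ?f0 // prodr_gt0.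
Qed.

Lemma logn_nprime p n : ~~ prime p -> logn p n = 0%N.
Proof. by rewrite lognE => /negbTE ->. Qed.

Lemma ln_factor n : (0 < n)%N ->
  ln n%:R = \sum_(1 <= p < n.+1 | prime p) ln p%:R *+ logn p n :> R.
Proof.
move=> n0; have := widen_partn predT (leqnn n); rewrite partnT // => {1}->.
rewrite natr_prod ln_prod; last first.
  move=> [|p] _; first by rewrite logn_nprime.
  by rewrite natrX exprn_gt0 // ltr0n.
rewrite big_nat_recl // logn_nprime // expn0 ln1 add0r.
rewrite [RHS]big_add1 /= [RHS]big_mkcond /=.
rewrite !big_nat; apply: eq_bigr => p _; rewrite natrX lnXn ?ltr0n //.
by case: ifP => // npp; rewrite logn_nprime // npp.
Qed.

(** A prime p contributes ln p once for each power p^k dividing n, that is [logn p n] times, which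
    rebuilds ln n from its factorization. *)
Lemma sum_vonMangoldt n N : (0 < n <= N)%N ->
  \sum_(1 <= d < N.+1 | (d %| n)%N) vonMangoldt d = ln n%:R.
Proof.
move=> /andP[n0 nN].
transitivity (\sum_(1 <= d < n.+1 | (d %| n)%N) vonMangoldt d).
  rewrite (big_cat_nat_idem _ (n := n.+1)) //=; last exact: addr0.
  rewrite [X in _ + X]big_nat_cond [X in _ + X]big1 ?addr0 // => d.
  by move=> /andP[/andP[nd _] /(dvdn_leq n0)]; rewrite leqNgt nd.
rewrite big_nat_cond.
under eq_bigr => d /andP[/andP[_ dn] _] do rewrite (vonMangoldtE (dn : (d <= n)%N)).
rewrite -big_nat_cond.
rewrite (exchange_big_dep prime) //= ln_factor //.
apply: eq_bigr => p pp.
rewrite (exchange_big_dep xpredT) //=.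
have lt_log : (logn p n < n.+1)%N by rewrite ltnW // ltnS ltn_logl.
rewrite (big_cat_nat_idem _ (n := (logn p n).+1)) //=; last exact: addr0.
rewrite [X in _ + X]big_nat_cond [X in _ + X]big1 ?addr0; last first.
  move=> k /andP[/andP[lk _] _]; rewrite big1_seq // => d.
  rewrite -andbA => /and3P[dv /eqP e _]; move: dv; rewrite -e pfactor_dvdn //.
  by rewrite leqNgt lk.
rewrite -[in RHS](subn0 (logn p n)) -subSS -sumr_const_nat !big_nat.
apply: eq_bigr => k /andP[k0 kl].
have dv : (p ^ k %| n)%N by rewrite pfactor_dvdn.
rewrite (big_rem (p ^ k)%N) /=; last first.
  by rewrite mem_index_iota expn_gt0 prime_gt0 //= ltnS dvdn_leq.
rewrite dv pp eqxx /= big1_seq ?addr0 // => d.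
by rewrite mem_rem_uniq ?iota_uniq // => /andP[/andP[_ /eqP ->]]; rewrite inE eqxx.
Qed.

Lemma vonMangoldt_le_ln n : vonMangoldt n <= ln n%:R.
Proof.
case: n => [|n]; first by rewrite /vonMangoldt big_geq // ln0.
rewrite -(sum_vonMangoldt (n:=n.+1) (N:=n.+1)) ?leqnn //.
rewrite big_mkcond big_nat_recr //= dvdnn lerDr sumr_ge0 // => d _.
by case: ifP => // _; exact: vonMangoldt_ge0.
Qed.

End ArithmeticFunctions.

Section Moebius.
Context {R : realType}.
Implicit Types n m k d p N : nat.

Definition moebius_factor n : R :=
  match n with 0 => 1 | 1 => -1 | _ => 0 end.

Definition moebius n : R := \prod_(1 <= p < n.+1 | prime p) moebius_factor (logn p n).

Lemma moebiusE n N : (0 < n <= N)%N ->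
  moebius n = \prod_(1 <= p < N.+1 | prime p) moebius_factor (logn p n).
Proof.
move=> /andP[n0 nN]; rewrite /moebius [RHS](big_cat_nat_idem _ (n := n.+1)) //=; last exact: mulr1.
rewrite [X in _ = _ * X]big_nat_cond [X in _ = _ * X]big1 ?mulr1 // => p.
move=> /andP[/andP[np _] pp].
by rewrite lognE pp n0 /= gtnNdvd.
Qed.

Lemma moebius_norm n : `|moebius n| <= 1.
Proof.
rewrite /moebius; elim/big_ind: _ => [|x y hx hy|p _]; first by rewrite normr1.
- by rewrite normrM mulr_ile1.
- by case: (logn p n) => [|[|e]] /=; rewrite ?normrN ?normr1 ?normr0.
Qed.

(** Only the factor at p changes: exponent 0 becomes 1, and a positive exponent becomes at least
    2. *)
Lemma moebius_mul p d : prime p -> (0 < d)%N ->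
  moebius (p * d) = if (p %| d)%N then 0 else - moebius d.
Proof.
move=> pp d0; have p0 := prime_gt0 pp.
have pd0 : (0 < p * d)%N by rewrite muln_gt0 p0.
rewrite (moebiusE (n := d) (N := p * d)) ?d0 ?leq_pmull // /moebius.
have pr : p \in index_iota 1 (p * d).+1.
  by rewrite mem_index_iota p0 ltnS leq_pmulr.
rewrite !(big_rem p pr) /= pp lognM // logn_prime // eqxx add1n.
have -> : \prod_(y <- rem p (index_iota 1 (p * d).+1) | prime y)
    moebius_factor (logn y (p * d)) =
  \prod_(y <- rem p (index_iota 1 (p * d).+1) | prime y) moebius_factor (logn y d).
  rewrite big_seq_cond [RHS]big_seq_cond; apply: eq_bigr => y.
  rewrite mem_rem_uniq ?iota_uniq // inE => /andP[/andP[yp _] py].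
  by rewrite lognM // logn_prime // (negbTE yp).
case: ifP => [|/negbT] dv; last first.
  by rewrite lognE pp d0 (negbTE dv) /= mul1r mulN1r.
by rewrite lognE pp d0 dv /= mul0r.
Qed.

(** Write n = p m with p the least prime factor. The divisors p i with p | i contribute 0; the other
    multiples of p cancel the divisors of n prime to p. *)
Lemma sum_moebius n N : (0 < n <= N)%N ->
  \sum_(1 <= d < N.+1 | (d %| n)%N) moebius d = (n == 1)%:R.
Proof.
move=> /andP[n0 nN].
have widen m M : (0 < m <= M)%N -> forall P : pred nat,
    \sum_(1 <= d < M.+1 | (d %| m)%N && P d) moebius d =
    \sum_(1 <= d < m.+1 | (d %| m)%N && P d) moebius d.
  move=> /andP[m0 mM] P; rewrite (big_cat_nat_idem _ (n := m.+1)) //=; last exact: addr0.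
  rewrite [X in _ + X]big_nat_cond [X in _ + X]big1 ?addr0 // => d.
  by move=> /andP[/andP[nd _] /andP[/(dvdn_leq m0)]]; rewrite leqNgt nd.
have := widen n N _ xpredT; rewrite n0 nN => /(_ isT).
under eq_bigl do rewrite andbT; move=> ->; under eq_bigl do rewrite andbT.
have [n1|->] : (1 < n)%N \/ n = 1%N by lia.
  have pp := pdiv_prime n1; set p := pdiv n in pp.
  have p0 := prime_gt0 pp.
  have [m nE] : exists m, n = (p * m)%N.
    by exists (n %/ p)%N; rewrite mulnC divnK // pdiv_dvd.
  have m0 : (0 < m)%N by move: n0; rewrite nE muln_gt0 => /andP[].
  rewrite (bigID (fun d => p %| d)%N) /=.
  rewrite [X in X + _](eq_bigl (fun d => (p %| d) && (d %| n))%N); last first.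
    by move=> d; rewrite andbC.
  rewrite big_mkcondr sum_multiples // nE mulKn //.
  have -> : \sum_(1 <= i < m.+1) (if (p * i %| p * m)%N then moebius (p * i) else 0) =
      \sum_(1 <= i < m.+1 | (i %| m)%N) moebius (p * i) :> R.
    by rewrite [RHS]big_mkcond; apply: eq_bigr => i _; rewrite dvdn_pmul2l.
  rewrite (bigID (fun d => p %| d)%N) /= big_nat_cond big1; last first.
    by move=> d /andP[/andP[d0 _] /andP[_ dv]]; rewrite moebius_mul // dv.
  rewrite add0r big_nat_cond.
  under eq_bigr => d /andP[/andP[d0 _] /andP[_ dv]] do
    rewrite moebius_mul // (negbTE dv).
  rewrite -big_nat_cond sumrN.
  rewrite [X in _ + X](eq_bigl (fun d => (d %| m)%N && ~~ (p %| d)%N)); last first.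
    move=> d; case dv: (p %| d)%N; rewrite ?andbF ?andbT //.
    by rewrite Gauss_dvdr // coprime_sym prime_coprime ?dv.
  by rewrite (widen m (p * m)%N) ?m0 ?leq_pmull // addNr -nE gtn_eqF.
by rewrite big_mkcond big_nat1 dvdnn /moebius big_mkcond big_nat1.
Qed.

(** Moebius inversion of [sum_vonMangoldt]: ln d is split as ln n - ln (n/d), and the part with ln n
    vanishes, since the Moebius sum is 0 unless n = 1, where ln n = 0. *)
Lemma sum_moebius_ln n N : (0 < n <= N)%N ->
  \sum_(1 <= d < N.+1 | (d %| n)%N) moebius d * ln d%:R = - vonMangoldt n.
Proof.
move=> nN; have /andP[n0 _] := nN.
have nn : (n <= N)%N by case/andP: nN.
(* The inner Moebius sum is 1 for e = n and 0 otherwise. *)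
have -> : vonMangoldt n = \sum_(1 <= e < N.+1 | (e %| n)%N)
    vonMangoldt e * \sum_(1 <= d < N.+1 | (d %| n %/ e)%N) moebius d :> R.
  rewrite (big_rem n) /=; last by rewrite mem_index_iota n0.
  rewrite dvdnn divnn n0 sum_moebius; last exact: leq_trans n0 nn.
  rewrite eqxx mulr1.
  rewrite big1_seq ?addr0 // => e /andP[dv].
  rewrite mem_rem_uniq ?iota_uniq // inE mem_index_iota => /and3P[en e0 _].
  have [m nE] : exists m, n = (m * e)%N by case/dvdnP: dv => m ->; exists m.
  have m0 : (0 < m)%N by move: n0; rewrite nE muln_gt0 => /andP[].
  have mE : (n %/ e = m)%N by rewrite nE mulnK.
  rewrite mE sum_moebius; last first.
    by rewrite m0 (leq_trans _ nn) // nE leq_pmulr.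
  case: eqP => [m1|_]; last by rewrite mulr0.
  by move: en; rewrite nE m1 mul1n eqxx.
under [in RHS]eq_bigr do rewrite mulr_sumr.
rewrite (exchange_big_dep (fun d => d %| n)%N) /=; last first.
  move=> e d en dv; apply: (dvdn_trans dv).
  by apply/dvdnP; exists e; rewrite mulnC divnK.
rewrite -sumrN.
transitivity (\sum_(1 <= d < N.+1 | (d %| n)%N) (moebius d * ln n%:R
   - moebius d * (ln (n %/ d)%:R))).
  rewrite big_nat_cond [RHS]big_nat_cond.
  apply: eq_bigr => d /andP[/andP[d0 _] dv]; rewrite -mulrBr; congr (_ * _).
  have q0 : (0 < n %/ d)%N by rewrite divn_gt0 // dvdn_leq.
  by rewrite -{1}(divnK dv) natrM lnM ?posrE ?ltr0n //; ring.
rewrite big_split /= -mulr_suml sum_moebius //.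
have -> : (n == 1)%:R * ln n%:R = 0 :> R.
  by case: eqP => [->|]; rewrite ?ln1 ?mulr0 ?mul0r.
rewrite add0r big_nat_cond [RHS]big_nat_cond; apply: eq_bigr => d.
move=> /andP[/andP[d0 _] dv]; congr (- _).
have q0 : (0 < n %/ d)%N by rewrite divn_gt0 // dvdn_leq.
rewrite -(sum_vonMangoldt (N := N)) ?q0 ?(leq_trans (leq_div _ _)) //.
rewrite mulr_sumr; apply: eq_big => [e|e _]; last by rewrite mulrC.
apply/idP/andP => [de|[en]].
  have := dvdn_mul de (dvdnn d); rewrite divnK // => edn.
  have en : (e %| n)%N by apply: dvdn_trans edn; rewrite dvdn_mulr.
  split=> //; have e0 := dvdn_gt0 n0 en.
  by rewrite -(dvdn_pmul2r e0) divnK // mulnC.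
move=> de; have := dvdn_mul de (dvdnn e); rewrite divnK // => edn.
by rewrite -(dvdn_pmul2r d0) divnK // mulnC.
Qed.

End Moebius.

(** * Chebyshev and Mertens estimates *)

Section ChebyshevMertens.
Context {R : realType}.
Implicit Types n m k d p N M : nat.
Implicit Types x y z : R.

Local Notation Lambda := (@vonMangoldt R).

Lemma ln_le_subr1 x : 0 < x -> ln x <= x - 1.
Proof.
move=> x0; have := @le_ln1Dx R (x - 1).
have -> : 1 + (x - 1) = x by ring.
by apply; lra.
Qed.

Lemma ln_ge_sub_inv x : 0 < x -> 1 - x^-1 <= ln x.
Proof.
move=> x0; have := @ln_le_subr1 x^-1; rewrite invr_gt0 lnV ?posrE // => /(_ x0).
by lra.
Qed.

Lemma ln_natS_le n : (0 < n)%N -> ln n.+1%:R - ln n%:R <= n%:R^-1 :> R.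
Proof.
move=> n0; have n0R : 0 < n%:R :> R by rewrite ltr0n.
rewrite -ln_div ?posrE ?ltr0n //; apply: (le_trans (ln_le_subr1 _)).
  by rewrite divr_gt0 // ltr0n.
by rewrite -natr1 mulrDl divff ?gt_eqF // mul1r addrAC subrr add0r.
Qed.

Lemma ln_natS_ge n : (0 < n)%N -> n.+1%:R^-1 <= ln n.+1%:R - ln n%:R :> R.
Proof.
move=> n0; have n0R : 0 < n%:R :> R by rewrite ltr0n.
rewrite -ln_div ?posrE ?ltr0n //; apply: le_trans (ln_ge_sub_inv _); last first.
  by rewrite divr_gt0 // ltr0n.
have nS0 : n.+1%:R != 0 :> R by rewrite pnatr_eq0.
rewrite invf_div -[X in X - _](divff nS0) -mulrBl -natr1 addrAC subrr add0r.
by rewrite mul1r natr1.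
Qed.

Lemma ln_sqrt x : 0 < x -> ln x = 2 * ln (Num.sqrt x).
Proof.
by move=> x0; rewrite -{1}(sqr_sqrtr (ltW x0)) lnXn ?sqrtr_gt0 // mulr_natl.
Qed.

Lemma ln_le_sqrt x : 0 < x -> ln x <= 2 * Num.sqrt x.
Proof.
move=> x0; rewrite ln_sqrt // ler_pM2l //.
by rewrite ltW // ln_sublinear // sqrtr_gt0.
Qed.

Lemma sqr_ln_le_sqrt x : 1 <= x -> ln x ^+ 2 <= 16 * Num.sqrt x.
Proof.
move=> x1; have x0 : 0 < x by lra.
have s0 : 0 < Num.sqrt x by rewrite sqrtr_gt0.
have h : ln x <= 4 * Num.sqrt (Num.sqrt x).
  by rewrite ln_sqrt //; have := ln_le_sqrt s0; lra.
have l0 : 0 <= ln x by rewrite ln_ge0.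
have := ler_pM l0 l0 h h; rewrite -!expr2 exprMn (sqr_sqrtr (ltW s0)).
by lra.
Qed.

(** Iterating [psi_half] yields Chebyshev's constant 2 ln 2, which has to stay below 3/2; 1.46 is
    enough. Three squarings show 1.091^8 >= 2, and ln a <= a - 1. *)
Lemma ln2_le : ln 2 <= 73 / 100 :> R.
Proof.
set a : R := 1091 / 1000.
have a0 : 0 < a by rewrite /a; lra.
have sq (x c : R) : 0 <= c -> c <= x -> c ^+ 2 <= x ^+ 2.
  by move=> c0 cx; rewrite ler_pXn2r // nnegrE // (le_trans c0).
have e2 : 119 / 100 <= a ^+ 2 by rewrite /a expr2; lra.
have e4 : 1416 / 1000 <= a ^+ 4.
  by rewrite (exprM a 2 2); apply: le_trans (sq _ _ _ e2); rewrite ?expr2; lra.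
have e8 : 2 <= a ^+ 8.
  by rewrite (exprM a 4 2); apply: le_trans (sq _ _ _ e4); rewrite ?expr2; lra.
have : ln 2 <= ln (a ^+ 8) by rewrite ler_ln // posrE ?exprn_gt0 // ltr0n.
by have := ln_le_subr1 a0; rewrite lnXn // -mulr_natl {2}/a; lra.
Qed.

Definition ln_fact N : R := \sum_(1 <= n < N.+1) ln n%:R.

Lemma ln_fact_ge N : (0 < N)%N -> N%:R * ln N%:R - N%:R <= ln_fact N.
Proof.
case: N => // N _; elim: N => [|N IH].
  by rewrite /ln_fact big_nat1 ln1; lra.
rewrite /ln_fact big_nat_recr //= -/(ln_fact N.+1).
have := @ln_natS_le N.+1 isT.
have n0 : 0 < N.+1%:R :> R by rewrite ltr0n.
rewrite -(ler_pM2l n0) divff ?gt_eqF //.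
move: IH; rewrite -[in N.+2%:R]natr1 !mulrDl mul1r; lra.
Qed.

Lemma ln_fact_le N : (0 < N)%N ->
  ln_fact N <= N%:R * ln N%:R - N%:R + ln N%:R + 1.
Proof.
case: N => // N _; elim: N => [|N IH].
  by rewrite /ln_fact big_nat1 ln1; lra.
rewrite /ln_fact big_nat_recr //= -/(ln_fact N.+1).
have := @ln_natS_ge N.+1 isT.
have n0 : 0 < N.+2%:R :> R by rewrite ltr0n.
rewrite -(ler_pM2l n0) divff ?gt_eqF //.
move: IH; rewrite -(natr1 N.+1) !mulrDl mul1r; lra.
Qed.

Lemma sum_hyperbola_swap (g : nat -> nat -> R) N :
  \sum_(1 <= n < N.+1) \sum_(1 <= m < (N %/ n).+1) g n m =
  \sum_(1 <= m < N.+1) \sum_(1 <= n < (N %/ m).+1) g n m.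
Proof.
have widen (h : nat -> R) n : (0 < n)%N -> \sum_(1 <= m < (N %/ n).+1) h m =
    \sum_(1 <= m < N.+1 | (m * n <= N)%N) h m.
  move=> n0; rewrite (big_nat_widen _ _ N.+1) ?ltnS ?leq_div //.
  by apply: eq_bigl => m; rewrite ltnS leq_divRL.
rewrite big_nat; under eq_bigr => n /andP[n0 _] do rewrite widen //.
rewrite -big_nat (exchange_big_dep xpredT) //=.
rewrite !big_nat; apply: eq_bigr => m /andP[m0 _].
by rewrite widen //; apply: eq_bigl => n; rewrite mulnC.
Qed.

Definition psi N : R := \sum_(1 <= n < N.+1) Lambda n.

Lemma psiE N : psi N = \sum_(1 <= n < N.+1) Lambda n.
Proof. by []. Qed.

Lemma psi_ge0 N : 0 <= psi N.
Proof. by apply: sumr_ge0 => n _; exact: vonMangoldt_ge0. Qed.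

Lemma psi_mono N M : (N <= M)%N -> psi N <= psi M.
Proof.
move=> NM; rewrite /psi (@big_cat_nat _ _ _ N.+1 1 M.+1) //=.
by rewrite lerDl sumr_ge0 // => n _; exact: vonMangoldt_ge0.
Qed.

(** Each ln k in ln N! is spread over the divisors of k, and n divides [N %/ n] of the integers up
    to N. *)
Lemma sum_vonMangoldt_floor N :
  \sum_(1 <= n < N.+1) Lambda n * (N %/ n)%:R = ln_fact N.
Proof.
transitivity (\sum_(1 <= n < N.+1) \sum_(1 <= m < (N %/ n).+1) Lambda n).
  by apply: eq_bigr => n _; rewrite sumr_const_nat subSS subn0 mulr_natr.
rewrite (sum_hyperbola (fun n _ => Lambda n)).
rewrite /ln_fact !big_nat; apply: eq_bigr => k /andP[k0 kN].
by rewrite sum_vonMangoldt ?k0.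
Qed.

Lemma sum_psi_floor N : \sum_(1 <= m < N.+1) psi (N %/ m) = ln_fact N.
Proof.
rewrite -sum_vonMangoldt_floor.
rewrite (sum_hyperbola_swap (fun m n => Lambda n)).
by apply: eq_bigr => n _; rewrite sumr_const_nat subSS subn0 mulr_natr.
Qed.

(* The integer [N %/ n - 2 * (N %/ 2 %/ n)] is nonnegative, and is 1 when
   N/2 < n <= N. *)
Lemma psi_half N : (1 < N)%N ->
  psi N <= psi (N %/ 2) + N%:R * ln 2 + 2 * ln N%:R + 2.
Proof.
move=> N1; set M := (N %/ 2)%N.
have M0 : (0 < M)%N by rewrite divn_gt0.
have MN : (M <= N)%N by rewrite leq_div.
have h : psi N - psi M <= ln_fact N - 2 * ln_fact M.
  rewrite -!sum_vonMangoldt_floor.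
  have -> : \sum_(1 <= n < M.+1) Lambda n * (M %/ n)%:R =
      \sum_(1 <= n < N.+1) Lambda n * (M %/ n)%:R.
    rewrite (@big_cat_nat _ _ _ M.+1 1 N.+1) //= [X in _ = _ + X]big_nat_cond.
    rewrite [X in _ = _ + X]big1 ?addr0 // => n /andP[/andP[Mn _] _].
    by rewrite divn_small // mulr0.
  rewrite mulr_sumr -sumrB.
  have -> : psi N - psi M = \sum_(M.+1 <= n < N.+1) Lambda n.
    by rewrite /psi (@big_cat_nat _ _ _ M.+1 1 N.+1) //= addrAC subrr add0r.
  have le0 n : 0 <= Lambda n * (N %/ n)%:R - 2 * (Lambda n * (M %/ n)%:R).
    rewrite mulrCA -mulrBr mulr_ge0 ?vonMangoldt_ge0 // subr_ge0 -natrM ler_nat.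
    case: (posnP n) => [->|n0]; first by rewrite !divn0 muln0.
    rewrite leq_divRL // -mulnA (leq_trans _ (leq_divM N 2)) // mulnC.
    by rewrite leq_mul2r leq_divM orbT.
  rewrite [X in _ <= X](@big_cat_nat _ _ _ M.+1 1 N.+1) //=.
  rewrite -[X in X <= _]add0r lerD ?sumr_ge0 //.
  rewrite big_nat [X in _ <= X]big_nat; apply: ler_sum => n /andP[Mn nN].
  rewrite (@divn_small M n) // mulr0 mulr0 subr0 ler_peMr ?vonMangoldt_ge0 //.
  by rewrite ler1n divn_gt0 // (leq_trans _ Mn).
have := ln_fact_le (ltnW N1); have := ln_fact_ge M0.
have N2M : (N <= 2 * M + 1)%N by rewrite /M; lia.
have M2N : (2 * M <= N)%N by rewrite /M; lia.
have M0R : 0 < M%:R :> R by rewrite ltr0n.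
have e1 : ln N%:R <= ln 2 + ln M%:R + (2 * M%:R)^-1 :> R.
  have : ln N%:R <= ln (2 * M).+1%:R :> R.
    by rewrite ler_ln ?posrE ?ltr0n ?(ltnW N1) // ler_nat -addn1.
  have := @ln_natS_le (2 * M); rewrite muln_gt0 M0 => /(_ isT).
  by rewrite natrM lnM ?posrE //; lra.
have l0 : 0 <= ln N%:R :> R by rewrite ln_ge0 // ler1n ltnW.
have e2 : N%:R * ln N%:R <= (2 * M%:R) * ln N%:R + ln N%:R :> R.
  rewrite -{3}[ln _]mul1r -mulrDl ler_wpM2r // -natrM natr1 ler_nat.
  by rewrite -addn1.
have e3 : (2 * M%:R) * ln N%:R <= 2 * M%:R * (ln 2 + ln M%:R) + 1 :> R.
  rewrite -[X in _ <= _ + X](divff (x := 2 * M%:R)); last first.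
    by rewrite mulf_neq0 ?pnatr_eq0 // -lt0n.
  by rewrite -mulrDr ler_wpM2l // mulr_ge0 // (ltW M0R).
have e4 : 2 * M%:R <= N%:R :> R by rewrite -natrM ler_nat.
have e5 : 0 <= ln (2 : R) by rewrite ln_ge0 // ler1n.
have e6 : 2 * M%:R * ln 2 <= N%:R * ln 2 :> R by rewrite ler_wpM2r.
by rewrite mulrDr in e3; lra.
Qed.

(** Halving is iterated: 0.73 N + 1.46 (N/2) = 1.46 N, and sqrt (N/2) <= 3/4 sqrt N leaves 24 - 18 =
    6 square roots for the error 2 ln N + 2 <= 4 sqrt N + 2. *)
Lemma psi_le_sqrt N : psi N <= 146 / 100 * N%:R + 24 * Num.sqrt N%:R.
Proof.
elim/ltn_ind: N => N IH.
have [N1|] := ltnP 1 N; last first.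
  case: N IH => [|[|//]] _ _.
    by rewrite /psi big_geq // sqrtr0; lra.
  rewrite /psi big_nat1 sqrtr1; have := @vonMangoldt_le_ln R 1; rewrite ln1; lra.
have := IH (N %/ 2)%N; rewrite ltn_Pdiv ?(ltnW N1) // => /(_ isT).
have := psi_half N1.
set M := (N %/ 2)%N.
have M2N : 2 * M%:R <= N%:R :> R by rewrite -natrM ler_nat /M; lia.
have N0 : 0 < N%:R :> R by rewrite ltr0n ltnW.
have sM : Num.sqrt M%:R <= 3 / 4 * Num.sqrt N%:R :> R.
  rewrite -[X in _ <= X]ger0_norm ?mulr_ge0 ?sqrtr_ge0 //; last by lra.
  rewrite -sqrtr_sqr ler_wsqrtr // exprMn (sqr_sqrtr (ltW N0)); lra.
have s1 : 1 <= Num.sqrt N%:R :> R by rewrite -[X in X <= _]sqrtr1 ler_wsqrtr // ler1n ltnW.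
have := ln_le_sqrt N0; have := ln2_le; move=> h1 h2.
have : N%:R * ln 2 <= N%:R * (73 / 100) :> R by rewrite ler_wpM2l // ltW.
by lra.
Qed.

Lemma psi_le N : psi N <= 26 * N%:R.
Proof.
apply: (le_trans (psi_le_sqrt N)).
have : Num.sqrt N%:R <= N%:R :> R.
  case: N => [|N]; first by rewrite sqrtr0.
  rewrite -[X in _ <= X]ger0_norm // -sqrtr_sqr ler_wsqrtr // expr2 -natrM ler_nat.
  by rewrite leq_pmulr.
have : 0 <= N%:R :> R by []. 
by lra.
Qed.

Definition mertens N : R := \sum_(1 <= n < N.+1) Lambda n / n%:R.

Lemma mertensE N : mertens N = \sum_(1 <= n < N.+1) Lambda n / n%:R.
Proof. by []. Qed.

Lemma mertens_ge N : (0 < N)%N -> ln N%:R - 1 <= mertens N.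
Proof.
move=> N0; have N0R : 0 < N%:R :> R by rewrite ltr0n.
rewrite -(ler_pM2l N0R); have := ln_fact_ge N0; rewrite -sum_vonMangoldt_floor.
move=> h; rewrite mulrBr mulr1; apply: (le_trans h).
rewrite /mertens mulr_sumr !big_nat; apply: ler_sum => n /andP[n0 _].
rewrite mulrCA ler_wpM2l ?vonMangoldt_ge0 // ler_pdivlMr ?ltr0n //.
by rewrite -natrM ler_nat leq_divM.
Qed.

(** Replacing [N %/ n] by N / n in the formula for ln N! costs at most psi N, which is O(N) by
    Chebyshev's bound. *)
Lemma mertens_le N : (0 < N)%N -> mertens N <= ln N%:R + 26.
Proof.
move=> N0; have N0R : 0 < N%:R :> R by rewrite ltr0n.
have h : N%:R * mertens N <= ln_fact N + psi N.
  rewrite -sum_vonMangoldt_floor /psi /mertens mulr_sumr -big_split /= !big_nat.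
  apply: ler_sum => n /andP[n0 _].
  rewrite mulrCA -[X in _ + X]mulr1 -mulrDr ler_wpM2l ?vonMangoldt_ge0 //.
  rewrite ler_pdivrMr ?ltr0n // natr1 -natrM ler_nat.
  by rewrite ltnW // ltn_ceil.
rewrite -(ler_pM2l N0R) mulrDr.
by have := ln_fact_le N0; have := psi_le N; have := ln_le_subr1 N0R; lra.
Qed.

End ChebyshevMertens.

(** * Selberg's formula *)

Section Selberg.
Context {R : realType}.
Implicit Types n m k d p N M : nat.
Implicit Types x y z : R.

Local Notation Lambda := (@vonMangoldt R).
Local Notation psi := (@psi R).
Local Notation mertens := (@mertens R).

Definition harmonic_sum N : R := \sum_(1 <= n < N.+1) n%:R^-1.

Lemma harmonic_sumS N : harmonic_sum N.+1 = harmonic_sum N + N.+1%:R^-1.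
Proof. by rewrite /harmonic_sum big_nat_recr. Qed.

(** This quantity and that of [harmonic_subln_inv_mono] enclose Euler's constant; their monotonicity
    lets the value at N serve as that constant for all M <= N, without a limit. *)
Lemma harmonic_subln_mono M N : (0 < M <= N)%N ->
  harmonic_sum N - ln N%:R <= harmonic_sum M - ln M%:R.
Proof.
move=> /andP[M0 MN]; elim: N MN => [|N IH]; first by rewrite leqNgt M0.
rewrite leq_eqVlt => /predU1P[->//|]; rewrite ltnS => MN.
apply: le_trans (IH MN); rewrite harmonic_sumS.
have := @ln_natS_ge R N (leq_trans M0 MN); set u := _^-1; lra.
Qed.

Lemma harmonic_subln_inv_mono M N : (0 < M <= N)%N ->
  harmonic_sum M - M%:R^-1 - ln M%:R <= harmonic_sum N - N%:R^-1 - ln N%:R.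
Proof.
move=> /andP[M0 MN]; elim: N MN => [|N IH]; first by rewrite leqNgt M0.
rewrite leq_eqVlt => /predU1P[->//|]; rewrite ltnS => MN.
apply: (le_trans (IH MN)); rewrite harmonic_sumS.
have := @ln_natS_le R N (leq_trans M0 MN); set u := N.+1%:R^-1; lra.
Qed.

Lemma sum_sqrt_inv N :
  \sum_(1 <= n < N.+1) (Num.sqrt n%:R)^-1 <= 2 * Num.sqrt N%:R :> R.
Proof.
elim: N => [|N IH]; first by rewrite big_geq // sqrtr0 mulr0.
rewrite big_nat_recr //=.
set a := Num.sqrt N%:R in IH *; set b := Num.sqrt _.
have a0 : 0 <= a by rewrite sqrtr_ge0.
have b0 : 0 < b by rewrite sqrtr_gt0 ltr0n.
have ab : b * b = a * a + 1 by rewrite -!expr2 !sqr_sqrtr // natr1.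
(* As b^2 - a^2 = 1, the new term is (b - a)(b + a) / b <= 2 (b - a), which telescopes. *)
have -> : b^-1 = (b * b - a * a) / b by rewrite ab addrAC subrr add0r mul1r.
have lab : a <= b by rewrite ler_wsqrtr // ler_nat.
suff : (b * b - a * a) / b <= 2 * (b - a) by lra.
by rewrite ler_pdivrMr //; nra.
Qed.

(** With y = N / n, a term is at most (ln y)^2 + 2 ln y <= 20 sqrt y, and the sum of sqrt (N / n) is
    at most 2 N. *)
Lemma selberg_error_sum N (E : nat -> R) : (0 < N)%N ->
  (forall n, (0 < n <= N)%N -> `|E n| <= ln (N%:R / n%:R) + 2) ->
  `|\sum_(1 <= n < N.+1) moebius n * ln (N%:R / n%:R) * E n| <= 40 * N%:R.
Proof.
move=> N0 hE; have N0R : 0 < N%:R :> R by rewrite ltr0n.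
have s0 : 0 < Num.sqrt N%:R :> R by rewrite sqrtr_gt0.
apply: (le_trans (ler_norm_sum _ _ _)).
apply: (@le_trans _ _ (\sum_(1 <= n < N.+1) 20 * Num.sqrt N%:R * (Num.sqrt n%:R)^-1)).
  rewrite !big_nat; apply: ler_sum => n /andP[n0 nN].
  have n0R : 0 < n%:R :> R by rewrite ltr0n.
  have y1 : 1 <= N%:R / n%:R :> R by rewrite ler_pdivlMr // mul1r ler_nat.
  have sy : Num.sqrt N%:R * (Num.sqrt n%:R)^-1 = Num.sqrt (N%:R / n%:R) :> R.
    by rewrite sqrtrM ?sqrtrV // ltW.
  rewrite -(mulrA 20) sy; have {sy} := hE n; rewrite n0 => /(_ nN).
  set y := N%:R / n%:R in y1 *; move=> hEn.
  have y0 : 0 < y by lra.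
  have l0 : 0 <= ln y by rewrite ln_ge0.
  rewrite !normrM (ger0_norm l0) -mulrA.
  have h1 : `|moebius n| * (ln y * `|E n|) <= ln y * `|E n| :> R.
    by rewrite ler_piMl ?mulr_ge0 // moebius_norm.
  have h2 : ln y * `|E n| <= ln y * (ln y + 2) by rewrite ler_wpM2l.
  have := sqr_ln_le_sqrt y1; have := ln_le_sqrt y0; rewrite expr2; lra.
rewrite -mulr_sumr; have h := sum_sqrt_inv N.
have : 20 * Num.sqrt N%:R * \sum_(1 <= n < N.+1) (Num.sqrt n%:R)^-1 <=
  20 * Num.sqrt N%:R * (2 * Num.sqrt N%:R) :> R by rewrite ler_pM2l // mulr_gt0.
have e : Num.sqrt N%:R * Num.sqrt N%:R = N%:R :> R by rewrite -expr2 sqr_sqrtr.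
nra.
Qed.

(* The Tatuzawa-Iseki inversion formula. *)
Lemma moebius_ln_inversion (F : nat -> R) N : (0 < N)%N ->
  \sum_(1 <= n < N.+1) moebius n * ln (N%:R / n%:R) *
     (\sum_(1 <= m < (N %/ n).+1) F (n * m)%N) =
  F 1 * ln N%:R + \sum_(1 <= k < N.+1) F k * Lambda k.
Proof.
move=> N0.
under eq_bigr do rewrite mulr_sumr.
rewrite (sum_hyperbola (fun n k => moebius n * ln (N%:R / n%:R) * F k)).
transitivity (\sum_(1 <= k < N.+1) ((k == 1%N)%:R * (F k * ln N%:R) + F k * Lambda k)).
  rewrite !big_nat; apply: eq_bigr => k /andP[k0 kN].
  rewrite -mulr_suml.
  have -> : \sum_(1 <= n < N.+1 | (n %| k)%N) moebius n * ln (N%:R / n%:R) =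
      (k == 1)%:R * ln N%:R + Lambda k.
    rewrite -(opprK (Lambda k)) -(sum_moebius_ln (n := k) (N := N)) ?k0 //.
    rewrite -(sum_moebius (n := k) (N := N)) ?k0 // mulr_suml -sumrB.
    rewrite big_nat_cond [RHS]big_nat_cond; apply: eq_bigr => n /andP[/andP[n0 _] _].
    by rewrite ln_div ?posrE ?ltr0n // mulrBr.
  by rewrite mulrDl; ring.
rewrite big_split /=; congr (_ + _).
rewrite big_ltn // eqxx mul1r big_nat big1 ?addr0 // => i /andP[i1 _].
by rewrite gtn_eqF // mul0r.
Qed.

(** Up to a logarithm, ln M! is M ln M - M and y times the harmonic sum is M (ln M + g); the
    constant 1 + g makes everything larger cancel. *)
Lemma selberg_inner M y g : (0 < M)%N -> M%:R <= y -> y < M%:R + 1 ->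
  harmonic_sum M - M%:R^-1 <= ln M%:R + g -> ln M%:R + g <= harmonic_sum M ->
  `|ln_fact M - y * harmonic_sum M + (1 + g) * M%:R| <= ln y + 2.
Proof.
move=> M0 My yM g1 g2; have M0R : 0 < M%:R :> R by rewrite ltr0n.
have hM : harmonic_sum M <= ln M%:R + 1.
  have := @harmonic_subln_mono 1 M; rewrite M0 => /(_ isT).
  by rewrite /harmonic_sum big_nat1 ln1 invr1; lra.
have lM : ln M%:R <= ln y by rewrite ler_ln // posrE; lra.
have h0 : 0 <= harmonic_sum M by apply: sumr_ge0 => n _; rewrite invr_ge0.
have := @ln_fact_le R _ M0; have := @ln_fact_ge R _ M0.
have inv : M%:R * M%:R^-1 = 1 :> R by rewrite divff // gt_eqF.
have g1' : M%:R * (harmonic_sum M - M%:R^-1) <= M%:R * (ln M%:R + g) by rewrite ler_pM2l.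
have g2' : M%:R * (ln M%:R + g) <= M%:R * harmonic_sum M by rewrite ler_pM2l.
have y1 : (y - M%:R) * harmonic_sum M <= 1 * harmonic_sum M by rewrite ler_wpM2r //; lra.
have y2 : 0 <= (y - M%:R) * harmonic_sum M by rewrite mulr_ge0 //; lra.
move: g1' g2' y1 y2; rewrite !(mulrDr, mulrDl, mulrN, mulNr) inv => g1' g2' y1 y2 h1 h2.
by rewrite ler_norml; apply/andP; split; lra.
Qed.

(* The inversion formula is applied to [psi (N %/ k) - N / k + 1 + g], whose
   sums over multiples are only logarithmic; g stands for Euler's constant. *)
Lemma selberg N : (0 < N)%N ->
  `|psi N * ln N%:R + \sum_(1 <= k < N.+1) Lambda k * psi (N %/ k)
    - 2 * N%:R * ln N%:R| <= 130 * N%:R.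
Proof.
move=> N0; have N0R : 0 < N%:R :> R by rewrite ltr0n.
pose g := harmonic_sum N - ln N%:R.
pose F k := psi (N %/ k) - N%:R / k%:R + (1 + g).
have g01 : 0 <= g <= 1.
  have := @harmonic_subln_mono 1 N; rewrite N0 => /(_ isT).
  have := @harmonic_subln_inv_mono 1 N; rewrite N0 => /(_ isT).
  rewrite /harmonic_sum !big_nat1 ln1 invr1 -/(harmonic_sum N) -/g => h1 h2.
  have : 0 < N%:R^-1 :> R by rewrite invr_gt0.
  by move=> h0; apply/andP; split; move: h1 h2; rewrite /g; lra.
have inner n : (0 < n <= N)%N -> `|\sum_(1 <= m < (N %/ n).+1) F (n * m)%N| <=
    ln (N%:R / n%:R) + 2.
  move=> /andP[n0 nN]; have n0R : 0 < n%:R :> R by rewrite ltr0n.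
  set M := (N %/ n)%N; have M0 : (0 < M)%N by rewrite divn_gt0.
  have -> : \sum_(1 <= m < M.+1) F (n * m)%N =
      ln_fact M - (N%:R / n%:R) * harmonic_sum M + (1 + g) * M%:R.
    rewrite /F big_split sumrB /= -sum_psi_floor sumr_const_nat subSS subn0 mulr_natr.
    congr (_ - _ + _); first by apply: eq_bigr => m _; rewrite divnMA.
    rewrite /harmonic_sum mulr_sumr; apply: eq_bigr => m _.
    by rewrite natrM invfM mulrA.
  apply: selberg_inner => //.
  - by rewrite ler_pdivlMr // -natrM ler_nat leq_divM.
  - by rewrite ltr_pdivrMr // natr1 -natrM ltr_nat ltn_ceil.
  - have := @harmonic_subln_inv_mono M N; rewrite M0 leq_div => /(_ isT).
    have : 0 < N%:R^-1 :> R by rewrite invr_gt0.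
    by rewrite /g; lra.
  - have := @harmonic_subln_mono M N; rewrite M0 leq_div => /(_ isT).
    by rewrite /g; lra.
have := selberg_error_sum N0 inner; rewrite moebius_ln_inversion //.
have -> : \sum_(1 <= k < N.+1) F k * Lambda k =
    \sum_(1 <= k < N.+1) Lambda k * psi (N %/ k) - N%:R * mertens N + (1 + g) * psi N.
  rewrite mertensE (psiE N) !mulr_sumr -sumrB -big_split /=; apply: eq_bigr => k _.
  by rewrite /F; set u := k%:R^-1; ring.
(* The main term 2 N ln N arises half from the summand - N of [F 1], multiplied by ln N, and half
   from [N * mertens N]; all else is O(N). *)
rewrite /F divn1 divr1.
set S := \sum_(1 <= k < N.+1) _.
have m1 := @mertens_ge R _ N0; rewrite -(ler_pM2l N0R) in m1.
have m2 := @mertens_le R _ N0; rewrite -(ler_pM2l N0R) in m2.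
have := @psi_le R N; have := @psi_ge0 R N; have := ln_le_subr1 N0R.
have l0 : 0 <= ln N%:R :> R by rewrite ln_ge0 // ler1n.
move: g01 => /andP[g0 g1].
move=> e1 e2 e3; rewrite !ler_norml => /andP[e6 e7].
have gl0 : 0 <= g * ln N%:R by rewrite mulr_ge0.
have gl1 : g * ln N%:R <= 1 * ln N%:R by rewrite ler_wpM2r.
have gp0 : 0 <= g * psi N by rewrite mulr_ge0.
have gp1 : g * psi N <= 1 * psi N by rewrite ler_wpM2r.
by apply/andP; split; lra.
Qed.

End Selberg.

(** * Selberg's formula for real arguments and over windows *)

Section RealVariable.
Context {R : realType}.
Implicit Types n m k d p N M : nat.
Implicit Types x y z : R.

Local Notation Lambda := (@vonMangoldt R).
Local Notation psi := (@psi R).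
Local Notation mertens := (@mertens R).
Local Notation tr := Num.truncn.

Definition Psi x := psi (tr x).

Lemma Psi_mono x y : x <= y -> Psi x <= Psi y.
Proof. by move=> xy; apply: psi_mono; exact: le_truncn. Qed.

Lemma Psi_ge0 x : 0 <= Psi x. Proof. exact: psi_ge0. Qed.

Lemma Psi_le x : 0 <= x -> Psi x <= 26 * x.
Proof.
by move=> x0; apply: (le_trans (psi_le _)); rewrite ler_pM2l // truncn_le.
Qed.

Lemma Psi_le_sqrt x : 0 <= x -> Psi x <= 146 / 100 * x + 24 * Num.sqrt x.
Proof.
move=> x0; apply: (le_trans (psi_le_sqrt _)).
have h : (tr x)%:R <= x by rewrite truncn_le.
by have := ler_wsqrtr h; lra.
Qed.

Lemma truncn_divn x k : 0 <= x -> (0 < k)%N -> tr (x / k%:R) = (tr x %/ k)%N.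
Proof.
move=> x0 k0; have k0R : 0 < k%:R :> R by rewrite ltr0n.
have /andP[h1 h2] := truncn_itv x0.
apply: truncn_def; rewrite ler_pdivlMr // ltr_pdivrMr // -!natrM.
rewrite (le_trans _ h1) ?ler_nat ?leq_divM //=.
by apply: (lt_le_trans h2); rewrite ler_nat ltn_ceil.
Qed.

Lemma truncn_gt0_ge1 x : 1 <= x -> (0 < tr x)%N.
Proof. by move=> x1; rewrite truncn_gt0. Qed.

Lemma ln_truncn_le x : 1 <= x -> ln (tr x)%:R <= ln x.
Proof.
move=> x1; have x0 : 0 < x by lra.
by rewrite ler_ln ?posrE ?ltr0n ?truncn_gt0 // truncn_le ltW.
Qed.

Lemma ln_truncn_ge x : 1 <= x -> ln x - (tr x)%:R^-1 <= ln (tr x)%:R.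
Proof.
move=> x1; have x0 : 0 < x by lra.
have N0 := truncn_gt0_ge1 x1.
have : ln x <= ln (tr x).+1%:R.
  by rewrite ler_ln ?posrE ?ltr0n // ltW // truncnS_gt.
by have := @ln_natS_le R _ N0; lra.
Qed.

Lemma selberg_real x : 1 <= x ->
  `|Psi x * ln x + \sum_(1 <= k < (tr x).+1) Lambda k * Psi (x / k%:R)
    - 2 * x * ln x| <= 170 * x.
Proof.
move=> x1; have x0 : 0 < x by lra.
have N0 := truncn_gt0_ge1 x1.
have -> : \sum_(1 <= k < (tr x).+1) Lambda k * Psi (x / k%:R) =
    \sum_(1 <= k < (tr x).+1) Lambda k * psi (tr x %/ k).
  rewrite !big_nat; apply: eq_bigr => k /andP[k0 _].
  by rewrite /Psi truncn_divn // ltW.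
have := @selberg R _ N0; have l1 := ln_truncn_le x1; have l2 := ln_truncn_ge x1.
have /andP[t1 t2] := truncn_itv (ltW x0); rewrite -natr1 in t2.
rewrite /Psi; have := psi_le (R := R) (tr x); have := psi_ge0 (R := R) (tr x).
move: N0 l1 l2 t1 t2; set N := tr x => N0 l1 l2 t1 t2 p0 p1.
have N0R : 0 < N%:R :> R by rewrite ltr0n.
have N1R : 1 <= N%:R :> R by rewrite ler1n.
have l0 : 0 <= ln N%:R :> R by rewrite ln_ge0.
have lx := ln_le_subr1 x0.
set S := \sum_(1 <= k < _) _.
rewrite !ler_norml => /andP[s1 s2].
pose e := ln x - ln N%:R.
have e0 : 0 <= e by rewrite /e; lra.
have eN : e * N%:R <= 1 by rewrite -ler_pdivlMr // mul1r /e; lra.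
have ex : e * x <= 2 by nra.
have ep : psi N * e <= 26.
  have : psi N * e <= 26 * N%:R * e by rewrite ler_wpM2r.
  by lra.
have ep0 : 0 <= psi N * e by rewrite mulr_ge0.
have f0 : 0 <= (x - N%:R) * ln N%:R by rewrite mulr_ge0 //; lra.
have f1 : (x - N%:R) * ln N%:R <= 1 * ln N%:R by rewrite ler_wpM2r //; lra.
have -> : ln x = e + ln N%:R by rewrite /e; lra.
have ex0 : 0 <= e * x by rewrite mulr_ge0 // ltW.
by apply/andP; split; lra.
Qed.

(** 340 A collects the errors 170 x' and 170 x of [selberg_real]; 28 A^2 pays for replacing ln x' by
    ln x, with 26 from Psi x' <= 26 x' and 2 from the main term. *)
Definition selberg_const (A : R) : R := 340 * A + 28 * A ^+ 2.

Lemma selberg_window A x x' : 1 <= A -> 1 <= x -> x <= x' -> x' <= A * x ->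
  `|(Psi x' - Psi x) * ln x
    + \sum_(1 <= k < (tr x').+1) Lambda k * (Psi (x' / k%:R) - Psi (x / k%:R))
    - 2 * (x' - x) * ln x| <= selberg_const A * x.
Proof.
move=> A1 x1 xx' x'A; have x0 : 0 < x by lra.
have x'1 : 1 <= x' by lra.
have NN : (tr x <= tr x')%N by exact: le_truncn.
have -> : \sum_(1 <= k < (tr x').+1) Lambda k * (Psi (x' / k%:R) - Psi (x / k%:R)) =
    \sum_(1 <= k < (tr x').+1) Lambda k * Psi (x' / k%:R)
    - \sum_(1 <= k < (tr x).+1) Lambda k * Psi (x / k%:R).
  transitivity (\sum_(1 <= k < (tr x').+1) Lambda k * Psi (x' / k%:R)
    - \sum_(1 <= k < (tr x').+1) Lambda k * Psi (x / k%:R)).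
    by rewrite -sumrB; apply: eq_bigr => k _; rewrite mulrBr.
  (* For k > x the integer part of x / k is 0, so extending the second sum up to x' adds nothing. *)
  congr (_ - _); rewrite (@big_cat_nat _ _ _ (tr x).+1 1 (tr x').+1) //=.
  rewrite [X in _ + X]big_nat_cond [X in _ + X]big1 ?addr0 // => k.
  move=> /andP[/andP[kx _] _]; rewrite /Psi truncn_divn ?(ltW x0) //; last by apply: leq_trans kx.
  by rewrite divn_small // psiE big_geq // mulr0.
have := selberg_real x1; have := selberg_real x'1; rewrite !ler_norml.
set S := \sum_(1 <= k < _) _; set S' := \sum_(1 <= k < _) _.
move=> /andP[s1 s2] /andP[s3 s4].
pose e := ln x' - ln x.
have e0 : 0 <= e by rewrite subr_ge0 ler_ln // posrE; lra.
have eA : e <= A.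
  rewrite /e -ln_div ?posrE; try lra.
  apply: (le_trans (ln_le_subr1 _)); first by rewrite divr_gt0 //; lra.
  suff : x' / x <= A by lra.
  by rewrite ler_pdivrMr.
have p0 : 0 <= Psi x' by exact: Psi_ge0.
have p1 : Psi x' <= 26 * x' by apply: Psi_le; lra.
have pe0 : 0 <= Psi x' * e by rewrite mulr_ge0.
have Ax : 0 <= A * x by rewrite mulr_ge0 //; lra.
have h1 : x' * e <= A ^+ 2 * x.
  have -> : A ^+ 2 * x = (A * x) * A by rewrite expr2; ring.
  by apply: ler_pM => //; lra.
have pe1 : Psi x' * e <= 26 * x' * e by rewrite ler_wpM2r.
have h2 : 0 <= x' * e by rewrite mulr_ge0 //; lra.
have h3 : x <= A * x by rewrite ler_peMl // ltW.
have e' : ln x' = e + ln x by rewrite /e; lra.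
rewrite /selberg_const; move: s1 s2; rewrite e' => s1 s2.
by apply/andP; split; lra.
Qed.

(** The sum over k in Selberg's formula is nonnegative and is dropped; dividing by ln x >= C / e
    makes the error at most e x. *)
Lemma Psi_window_le A (e : R) : 1 <= A -> 0 < e ->
  exists2 Y : R, 1 <= Y & forall x x', Y <= x -> x <= x' -> x' <= A * x ->
    Psi x' - Psi x <= 2 * (x' - x) + e * x.
Proof.
move=> A1 e0; pose C := selberg_const A.
have C0 : 0 < C by rewrite /C /selberg_const; have := sqr_ge0 A; lra.
exists (expR (C / e)).
  by rewrite -expR0 ler_expR divr_ge0 // ltW.
move=> x x' Yx xx' x'A.
have x1 : 1 <= x by apply: le_trans Yx; rewrite -expR0 ler_expR divr_ge0 // ltW.
have x0 : 0 < x by lra.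
have lx : C / e <= ln x by rewrite -[X in X <= _]expRK ler_ln ?posrE ?expR_gt0.
have lx0 : 0 < ln x by apply: lt_le_trans lx; rewrite divr_gt0.
have := selberg_window A1 x1 xx' x'A; rewrite ler_norml => /andP[_].
set S := \sum_(1 <= k < _) _.
have S0 : 0 <= S.
  rewrite /S big_nat_cond; apply: sumr_ge0 => k /andP[/andP[k0 _] _].
  rewrite mulr_ge0 ?vonMangoldt_ge0 // subr_ge0 Psi_mono //.
  by rewrite ler_pM2r // invr_gt0 ltr0n.
move=> h; have h1 : (Psi x' - Psi x) * ln x <= (2 * (x' - x)) * ln x + C * x.
  by rewrite -/C in h; lra.
rewrite -(ler_pM2r lx0) [X in _ <= X]mulrDl; apply: (le_trans h1); rewrite lerD2l.
rewrite -mulrA [x * _]mulrC mulrA ler_pM2r //.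
by move: lx; rewrite ler_pdivrMr // mulrC.
Qed.

Lemma mertens_real x : 1 <= x -> ln x - 2 <= mertens (tr x) <= ln x + 26.
Proof.
move=> x1; have N0 := truncn_gt0_ge1 x1.
have := @mertens_ge R _ N0; have := @mertens_le R _ N0.
have := ln_truncn_le x1; have := ln_truncn_ge x1.
have : (tr x)%:R^-1 <= 1 :> R by rewrite invf_le1 ?ltr0n // ler1n.
by move=> h1 h2 h3 h4 h5; apply/andP; split; lra.
Qed.

Lemma mertens_window x x' : 1 <= x -> x <= x' ->
  ln x' - ln x - 28 <= \sum_((tr x).+1 <= k < (tr x').+1) Lambda k / k%:R
    <= ln x' - ln x + 28.
Proof.
move=> x1 xx'; have x'1 : 1 <= x' by lra.
have NN : (tr x <= tr x')%N by exact: le_truncn.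
have -> : \sum_((tr x).+1 <= k < (tr x').+1) Lambda k / k%:R = mertens (tr x') - mertens (tr x).
  by rewrite !mertensE (@big_cat_nat _ _ _ (tr x).+1 1 (tr x').+1) //= addrAC subrr add0r.
have /andP[h1 h2] := mertens_real x1; have /andP[h3 h4] := mertens_real x'1.
by apply/andP; split; lra.
Qed.

Lemma Psi_sub x x' : x <= x' ->
  Psi x' - Psi x = \sum_((tr x).+1 <= k < (tr x').+1) Lambda k.
Proof.
move=> xx'; have NN : (tr x <= tr x')%N by exact: le_truncn.
by rewrite /Psi !psiE (@big_cat_nat _ _ _ (tr x).+1 1 (tr x').+1) //= addrAC subrr add0r.
Qed.

Lemma truncn_window x x' k : 0 <= x -> 0 <= x' ->
  ((tr x).+1 <= k < (tr x').+1)%N = (x < k%:R <= x').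
Proof. by move=> x0 x'0; rewrite truncn_lt_nat // ltnS truncn_ge_nat. Qed.

End RealVariable.

(** * Primes in short intervals *)

Section Erdos.
Context {R : realType}.
Implicit Types n m k d p N M : nat.
Implicit Types x y z t : R.

Local Notation Lambda := (@vonMangoldt R).
Local Notation mertens := (@mertens R).
Local Notation Psi := (@Psi R).
Local Notation tr := Num.truncn.

Lemma bernoulli_ge (h : R) n : 1 <= h -> 1 + n%:R * (h - 1) <= h ^+ n.
Proof.
move=> h1; elim: n => [|n IH]; first by rewrite expr0 mul0r addr0.
have q1 : 0 <= (h - 1) * (h ^+ n - (1 + n%:R * (h - 1))) by rewrite mulr_ge0; lra.
have q2 : 0 <= n%:R * (h - 1) ^+ 2 by rewrite mulr_ge0 // sqr_ge0.
by rewrite exprS -natr1; lra.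
Qed.

Definition dense_ratio (b : R) := exists2 e : R, 0 < e &
  exists2 X : R, 1 <= X & forall x, X <= x -> e * x <= Psi (b * x) - Psi x.

Lemma dense_ratio_mono (a b : R) : a <= b -> dense_ratio a -> dense_ratio b.
Proof.
move=> ab [e e0 [X X1 h]]; exists e => //; exists X => // x Xx.
apply: (le_trans (h x Xx)); rewrite lerD2r Psi_mono // ler_pM2r //; lra.
Qed.

(** Over a window of ratio e^29, Mertens' estimate makes the sum of Lambda k / k at least 29 - 28 =
    1, and x / k < 1 there. *)
Lemma dense_ratio_exp : dense_ratio (expR 29).
Proof.
exists 1 => //; exists 1 => // x x1; rewrite mul1r.
have x0 : 0 < x by lra.
have b1 : 1 <= expR 29 :> R by have := @expR_ge1Dx R 29; lra.
have xbx : x <= expR 29 * x by rewrite ler_peMl // ltW.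
have /andP[h _] := mertens_window x1 xbx; move: h.
rewrite lnM ?posrE ?expR_gt0 // expRK Psi_sub // => h.
have {h} : 1 <= \sum_((tr x).+1 <= k < (tr (expR 29 * x)).+1) Lambda k / k%:R by lra.
rewrite -(ler_pM2l x0) mulr1 => h; apply: (le_trans h).
rewrite mulr_sumr !big_nat; apply: ler_sum => k.
rewrite truncn_window ?(ltW x0) ?mulr_ge0 // ?expR_ge0 ?(ltW x0) // => /andP[xk _].
have k0 : 0 < k%:R :> R by lra.
by rewrite mulrCA ler_piMr ?vonMangoldt_ge0 // ler_pdivrMr // mul1r ltW.
Qed.

(** The gains of successive steps add up, and each step multiplies T by at least h, so by
    Bernoulli's inequality 100 T0 is reached after boundedly many. *)
Lemma chain_growth (h T0 : R) (P : R -> R) : 1 < h -> 0 < T0 ->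
  (forall T, T0 <= T -> T < 100 * T0 ->
     exists2 T', h * T <= T' & 3 / 2 * (T' - T) <= P T' - P T) ->
  exists2 T, 100 * T0 <= T & 3 / 2 * (T - T0) <= P T - P T0.
Proof.
move=> h1 T00 step.
have chain l : exists2 T, 3 / 2 * (T - T0) <= P T - P T0 &
    T0 <= T /\ (100 * T0 <= T \/ h ^+ l * T0 <= T).
  elim: l => [|l [T PT [TT0 H]]].
    by exists T0; rewrite ?subrr ?mulr0 // expr0 mul1r; split=> //; right.
  have [?|T100] := lerP (100 * T0) T; first by exists T => //; split=> //; left.
  have [T' hT' PT'] := step T TT0 T100.
  have TT' : T <= h * T by rewrite ler_peMl //; lra.
  exists T'; first by lra.
  split; first by lra.
  right; case: H => H; first by lra.
  rewrite exprS -mulrA; apply: le_trans hT'; rewrite ler_pM2l //; lra.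
pose l := (tr (100 / (h - 1))).+1.
have hl : 100 <= h ^+ l.
  apply: le_trans (bernoulli_ge l (ltW h1)); have u0 : 0 < h - 1 by lra.
  have : 100 / (h - 1) < l%:R by rewrite truncnS_gt.
  by rewrite ltr_pdivrMr //; set w := l%:R * _; lra.
have [T PT [TT0 H]] := chain l; exists T => //.
case: H => // H; apply: le_trans H.
by rewrite ler_pM2r.
Qed.

(* [e] is the error allowed in Selberg's upper bound [density <= 2].  Starting
   from [T], the interval (v, a v] of density almost 2 is taken with [v] in
   [h T / a, h^2 T): either it overlaps (0, T], or the gap (T, v] is short
   compared with it.  In both cases the density on (T, a v] is at least 3/2,
   and iterating contradicts [Psi x <= 1.46 x + o(x)]. *)
Lemma double_density_absurd (a h e Y t0 : R) : 1 < h -> 1 + 8 * (h - 1) <= a ->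
  1000 ^+ 2 <= Y -> Y <= t0 -> e <= (h - 1) / 4 ->
  (forall x x', Y <= x -> x <= x' -> x' <= a * x ->
     Psi x' - Psi x <= 2 * (x' - x) + e * x) ->
  (forall t, t0 <= t -> t <= 100 * t0 -> exists2 v, t <= v < a * h * t &
     (2 * (a - 1) - (h - 1) / 4) * v <= Psi (a * v) - Psi v) ->
  False.
Proof.
move=> h1 ah Y6 Yt0 eu upper lower.
have a1 : 1 < a by lra.
have h0 : 0 < h by lra. have a0 : 0 < a by lra.
have Y0 : 0 < Y by apply: lt_le_trans Y6; rewrite exprn_gt0.
have t00 : 0 < t0 by lra.
(* With this choice t = T h / a runs through [t0, 100 t0] when T runs through [T0, 100 T0]. *)
pose T0 := t0 * a / h.
have ha : h <= a by lra.
have T00 : 0 < T0 by rewrite /T0 divr_gt0 // mulr_gt0.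
have t0T0 : t0 <= T0 by rewrite /T0 ler_pdivlMr // ler_pM2l.
have step T : T0 <= T -> T < 100 * T0 ->
    exists2 T', h * T <= T' & 3 / 2 * (T' - T) <= Psi T' - Psi T.
  move=> TT0 T100; pose t := T * h / a.
  have T1 : 0 < T by lra.
  have t1 : t0 <= t by rewrite /t ler_pdivlMr // -ler_pdivrMr.
  have t2 : t <= 100 * t0.
    rewrite /t ler_pdivrMr // -ler_pdivlMr //.
    have -> : 100 * t0 * a / h = 100 * T0 by rewrite /T0 !mulrA.
    exact: ltW.
  have [v /andP[tv vt] dv] := lower t t1 t2.
  have v0 : 0 < v by lra.
  have hTv : h * T <= a * v.
    by rewrite mulrC [a * v]mulrC -ler_pdivrMr.
  have vT : v < h * (h * T).
    have -> : h * (h * T) = a * h * t by rewrite /t; field; apply/eqP; lra.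
    by [].
  exists (a * v) => //.
  (* In the overlapping case (v, T] has density at most about 2, so (T, a v] keeps density nearly 2;
     the total error (h - 1) v / 2 is at most half of a v - T. *)
  have [vTlt|Tv] := lerP v T.
    have up : Psi T - Psi v <= 2 * (T - v) + e * v.
      apply: upper => //; first by lra.
      by apply: le_trans hTv; rewrite ler_peMl //; lra.
    have : (h - 1) * v <= (h - 1) * T by rewrite ler_pM2l //; lra.
    have : e * v <= (h - 1) / 4 * v by rewrite ler_pM2r.
    by lra.
  have Tm : Psi T <= Psi v by rewrite Psi_mono // ltW.
  (* With u = h - 1, v < h^2 T and (1 - 2u)(1 + u)^2 <= 1 bound the gap v - T by 2 u v. As a - 1 >=
     8 u, the gap leaves density at least 3/2. *)
  have vh : v * (1 - 2 * (h - 1)) <= T.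
    have h2 : (1 - 2 * (h - 1)) * (h * h) <= 1.
      suff : 0 <= (h - 1) ^+ 2 * (2 * h + 1) by lra.
      by rewrite mulr_ge0 ?sqr_ge0 //; lra.
    have [neg|pos] := lerP (1 - 2 * (h - 1)) 0.
      by apply: le_trans (ltW T1); rewrite pmulr_rle0.
    have : (1 - 2 * (h - 1)) * v <= (1 - 2 * (h - 1)) * (h * (h * T)).
      by rewrite ler_pM2l // ltW.
    have : (1 - 2 * (h - 1)) * (h * h) * T <= 1 * T by rewrite ler_pM2r.
    by lra.
  have : (1 + 8 * (h - 1)) * v <= a * v by rewrite ler_pM2r.
  have : 0 <= (h - 1) * v by rewrite mulr_ge0 //; lra.
  by lra.
(* Now Psi T >= 3/2 (T - T / 100) = 1.485 T, against 1.46 T + 24 sqrt T <= 1.484 T, because sqrt T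
   >= 1000. *)
have [T T100 PT] := chain_growth h1 T00 step.
have T1 : 0 < T by lra.
have s1 : 1000 <= Num.sqrt T.
  rewrite -[X in X <= _](ger0_norm (x := 1000)) // -sqrtr_sqr ler_wsqrtr //; lra.
have s2 : Num.sqrt T * Num.sqrt T = T by rewrite -expr2 sqr_sqrtr // ltW.
have s3 : 1000 * Num.sqrt T <= Num.sqrt T * Num.sqrt T by rewrite ler_pM2r //; lra.
have := Psi_le_sqrt (ltW T1); have := Psi_ge0 T0.
by lra.
Qed.

(* The relative shortfall of (x/k, a x/k] from density 2; the slack [e] makes it
   nonnegative by Selberg's upper bound. *)
Definition deficit (a e x : R) k :=
  2 * (a - 1) + e - (Psi (a * x / k%:R) - Psi (x / k%:R)) * (k%:R / x).

Lemma deficit_ge0 (a e x Y : R) k : 1 <= a -> 1 <= Y ->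
  (forall x x', Y <= x -> x <= x' -> x' <= a * x ->
     Psi x' - Psi x <= 2 * (x' - x) + e * x) ->
  0 < x -> (0 < k)%N -> k%:R <= x / Y -> 0 <= deficit a e x k.
Proof.
move=> a1 Y1 upper x0 k0 kx; have k0R : 0 < k%:R :> R by rewrite ltr0n.
have Y0 : 0 < Y by lra.
have v0 : 0 < x / k%:R by rewrite divr_gt0.
have Yv : Y <= x / k%:R by rewrite ler_pdivlMr // mulrC -ler_pdivlMr.
have := upper (x / k%:R) (a * (x / k%:R)) Yv.
rewrite ler_peMl ?(ltW v0) // => /(_ isT (lexx _)).
rewrite /deficit -(mulrA a x) -[k%:R / x]invf_div.
set v := x / k%:R in v0 *; set P := _ - _ => up.
by rewrite subr_ge0 ler_pdivrMr //; lra.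
Qed.

(** When (x, a x] carries little, Selberg's formula forces the weighted sum over the windows (x/k, a
    x/k] up to nearly 2 (a - 1) x ln x, so the total deficit is small. The summands of the constant
    bound the errors of Mertens and of Selberg, and the range k > x / Y by Chebyshev. *)
Lemma deficit_sum (a e Y : R) : 1 <= a -> 0 < e -> 1 <= Y ->
  exists C : R, forall d x : R, Y <= x -> Psi (a * x) - Psi x <= d * x ->
    \sum_(1 <= k < (tr (x / Y)).+1) Lambda k / k%:R * deficit a e x k
      <= (e + d) * ln x + C.
Proof.
move=> a1 e0 Y1.
exists ((2 * (a - 1) + e) * 26 + selberg_const a + 26 * a * (ln (a * Y) + 28)).
move=> d x Yx bad; have x1 : 1 <= x by lra.
have x0 : 0 < x by lra. have Y0 : 0 < Y by lra. have a0 : 0 < a by lra.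
have xax : x <= a * x by rewrite ler_peMl // ltW.
have xY1 : 1 <= x / Y by rewrite ler_pdivlMr // mul1r.
have xYx : x / Y <= x by rewrite ler_pdivrMr // ler_peMr // ltW.
have xYax : x / Y <= a * x by lra.
have NN : (tr (x / Y) <= tr (a * x))%N by exact: le_truncn.
have := selberg_window a1 x1 xax (lexx _).
rewrite ler_norml => /andP[+ _].
rewrite (@big_cat_nat _ _ _ (tr (x / Y)).+1 1 (tr (a * x)).+1) //=.
set D1 := \sum_(1 <= k < _) _; set D2 := \sum_(_ <= k < _) _ => sel.
have D2le : D2 <= 26 * a * x * (ln (a * Y) + 28).
  have /andP[_ mw] := mertens_window xY1 xYax.
  have lE : ln (a * x) - ln (x / Y) = ln (a * Y).
    by rewrite ln_div ?posrE // !lnM ?posrE //; lra.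
  rewrite lE in mw; have ax0 : 0 < 26 * a * x by rewrite !mulr_gt0.
  rewrite -(ler_pM2l ax0) in mw; apply: le_trans mw.
  rewrite mulr_sumr /D2 !big_nat; apply: ler_sum => k.
  rewrite truncn_window; [|lra..] => /andP[xk kax].
  have k0 : 0 < k%:R :> R by lra.
  rewrite mulrCA ler_wpM2l ?vonMangoldt_ge0 //.
  have := Psi_ge0 (x / k%:R).
  have : Psi (a * x / k%:R) <= 26 * (a * x / k%:R).
    by apply: Psi_le; rewrite divr_ge0 ?mulr_ge0 // ltW.
  by rewrite !mulrA; lra.
have SE : \sum_(1 <= k < (tr (x / Y)).+1) Lambda k / k%:R * deficit a e x k =
    (2 * (a - 1) + e) * mertens (tr (x / Y)) - D1 / x.
  rewrite mertensE mulr_sumr /D1 mulr_suml -sumrB !big_nat; apply: eq_bigr => k /andP[k0 _].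
  rewrite /deficit; set P := Psi _ - _.
  have kR : k%:R != 0 :> R by rewrite pnatr_eq0 -lt0n.
  have xR : x != 0 by rewrite gt_eqF.
  by field; rewrite kR xR.
rewrite SE -(ler_pM2r x0) mulrBl divfK ?gt_eqF //.
have /andP[_ m] := mertens_real xY1.
have lxY : ln (x / Y) <= ln x by rewrite ler_ln ?posrE ?divr_gt0.
have m' : mertens (tr (x / Y)) <= ln x + 26 by lra.
have c0 : 0 < 2 * (a - 1) + e by lra.
rewrite -(ler_pM2l c0) -(ler_pM2r x0) in m'.
have lx0 : 0 <= ln x by rewrite ln_ge0.
have bad' : (Psi (a * x) - Psi x) * ln x <= d * x * ln x by rewrite ler_wpM2r.
by lra.
Qed.

(** The stretches are consecutive, so their sums add up. Used by contraposition: a small total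
    leaves a stretch with sum at most tau. *)
Lemma stretch_pigeonhole (f : nat -> R) (tau X B : R) I : 1 <= X -> 1 <= B ->
  (forall k, (0 < k)%N -> k%:R <= X * B ^+ I -> 0 <= f k) ->
  (forall i, (i < I)%N ->
     tau <= \sum_((tr (X * B ^+ i)).+1 <= k < (tr (X * B ^+ i.+1)).+1) f k) ->
  I%:R * tau <= \sum_(1 <= k < (tr (X * B ^+ I)).+1) f k.
Proof.
move=> X1 B1; have X0 : 0 < X by lra.
elim: I => [|I IH] f0 hI.
  rewrite mul0r big_nat; apply: sumr_ge0 => k /andP[k0 kI].
  apply: f0 => //; move: kI; rewrite ltnS truncn_ge_nat // mulr_ge0 ?exprn_ge0 //; lra.
have BI : X * B ^+ I <= X * B ^+ I.+1.
  by rewrite ler_pM2l // exprS ler_peMl // exprn_ge0 //; lra.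
rewrite (@big_cat_nat _ _ _ (tr (X * B ^+ I)).+1 1 (tr (X * B ^+ I.+1)).+1) //=; last first.
  by rewrite ltnS le_truncn.
rewrite -natr1 mulrDl mul1r lerD //; last exact: hI.
apply: IH => [k k0 kI|i iI]; first by apply: f0 => //; lra.
by apply: hI; rewrite ltnW.
Qed.

(** If g exceeded kap on all of (y, b y], this interval alone would weigh at least (Psi (b y) - Psi
    y) kap / (b y) >= kap e / b > tau. *)
Lemma window_small_deficit (g : nat -> R) (b z z' y kap tau e : R) :
  0 < z -> 0 < b -> 0 < kap -> z <= y -> b * y <= z' -> y <= b * y ->
  e * y <= Psi (b * y) - Psi y ->
  tau < kap * e / b ->
  (forall k, z < k%:R <= z' -> 0 <= g k) ->
  \sum_((tr z).+1 <= k < (tr z').+1) Lambda k / k%:R * g k <= tau ->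
  exists2 k, y < k%:R <= b * y & g k <= kap.
Proof.
move=> z0 b0 kap0 zy byz yby dens tauE g0 small; apply: contrapT => none.
have y0 : 0 < y by lra.
have by0 : 0 < b * y by rewrite mulr_gt0.
have gk k : y < k%:R <= b * y -> kap <= g k.
  by move=> hk; rewrite leNgt; apply/negP => /ltW h; apply: none; exists k.
suff : kap * e / b <= \sum_((tr z).+1 <= k < (tr z').+1) Lambda k / k%:R * g k by lra.
have n1 : ((tr z).+1 <= (tr y).+1)%N by rewrite ltnS le_truncn.
have n2 : ((tr y).+1 <= (tr (b * y)).+1)%N by rewrite ltnS le_truncn.
have n3 : ((tr (b * y)).+1 <= (tr z').+1)%N by rewrite ltnS le_truncn.
have term k : z < k%:R <= z' -> 0 <= Lambda k / k%:R * g k.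
  by move=> hk; rewrite mulr_ge0 ?g0 // divr_ge0 ?vonMangoldt_ge0.
rewrite (@big_cat_nat _ _ _ (tr y).+1) //=; last exact: leq_trans n3.
rewrite [X in _ <= _ + X](@big_cat_nat _ _ _ (tr (b * y)).+1) //=.
have s1 : 0 <= \sum_((tr z).+1 <= k < (tr y).+1) Lambda k / k%:R * g k.
  rewrite big_nat; apply: sumr_ge0 => k.
  rewrite truncn_window ?(ltW y0) ?(ltW z0) // => /andP[h1 h2].
  by apply: term; rewrite h1 /=; lra.
have s3 : 0 <= \sum_((tr (b * y)).+1 <= k < (tr z').+1) Lambda k / k%:R * g k.
  rewrite big_nat; apply: sumr_ge0 => k.
  rewrite truncn_window ?(ltW by0) //; last by lra.
  by move=> /andP[h1 h2]; apply: term; rewrite h2 andbT; lra.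
suff : kap * e / b <= \sum_((tr y).+1 <= k < (tr (b * y)).+1) Lambda k / k%:R * g k by lra.
apply: (@le_trans _ _ (kap / (b * y) * (Psi (b * y) - Psi y))).
  have -> : kap * e / b = kap / (b * y) * (e * y).
    by field; rewrite !gt_eqF.
  by rewrite ler_pM2l // divr_gt0.
rewrite Psi_sub // mulr_sumr !big_nat; apply: ler_sum => k.
rewrite truncn_window ?(ltW y0) ?(ltW z0) ?(ltW by0) // => hk; have /andP[h1 h2] := hk.
have k0 : 0 < k%:R :> R by lra.
rewrite [X in X <= _]mulrC -mulrA ler_wpM2l ?vonMangoldt_ge0 //.
rewrite mulrC; apply: ler_pM; rewrite ?invr_ge0 ?(ltW by0) ?(ltW kap0) //.
  by rewrite lef_pV2 ?posrE.
exact: gk.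
Qed.

Lemma not_dense_ratio (a : R) : ~ dense_ratio a -> forall e X : R, 0 < e -> 1 <= X ->
  exists2 x, X <= x & Psi (a * x) - Psi x <= e * x.
Proof.
move=> nd e X e0 X1; apply: contrapT => none; apply: nd.
exists e => //; exists X => // x Xx; rewrite leNgt; apply/negP => /ltW h.
by apply: none; exists x.
Qed.

(** About ln x / ln B stretches fit between Z and x; tau ln x / ln B is at least twice e ln x and
    outgrows the constant C. *)
Lemma stretch_count (Z B C tau x e : R) : 1 <= Z -> 1 < B -> 0 < tau -> 0 <= C ->
  e <= tau / (2 * ln B) -> Z <= x ->
  2 * (C + tau) * ln B / tau + 2 * ln Z < ln x ->
  exists2 I : nat, Z * B ^+ I <= x & e * ln x + C < I%:R * tau.
Proof.
move=> Z1 B1 tau0 C0 eE Zx xE.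
have Z0 : 0 < Z by lra. have x0 : 0 < x by lra. have B0 : 0 < B by lra.
have lB : 0 < ln B by rewrite ln_gt0.
have lx : 0 <= ln x by rewrite ln_ge0 //; lra.
pose I := tr ((ln x - ln Z) / ln B).
have q0 : 0 <= (ln x - ln Z) / ln B.
  by rewrite divr_ge0 ?(ltW lB) // subr_ge0 ler_ln ?posrE.
have /andP[I1 I2] := truncn_itv q0; rewrite -/I -natr1 in I1 I2.
exists I.
  rewrite -ler_ln ?posrE ?mulr_gt0 ?exprn_gt0 // lnM ?posrE ?exprn_gt0 // lnXn //.
  by rewrite -mulr_natl; move: I1; rewrite ler_pdivlMr //; set w := I%:R * _; lra.
have e1 : e * ln x <= tau / (2 * ln B) * ln x by rewrite ler_wpM2r.
apply: (le_lt_trans (y := tau / (2 * ln B) * ln x + C)); first by lra.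
rewrite ltr_pdivrMr // in I2.
have I3 : (ln x - ln Z) * tau < (I%:R + 1) * ln B * tau by rewrite ltr_pM2r.
have lB2 : 0 < 2 * ln B by lra.
rewrite -(ltr_pM2r lB2) mulrDl mulrAC divfK ?gt_eqF //.
have : (2 * (C + tau) * ln B / tau + 2 * ln Z) * tau < ln x * tau by rewrite ltr_pM2r.
rewrite mulrDl divfK ?gt_eqF //.
by set w := I%:R in I3 *; lra.
Qed.

(* If [a] were not dense, there would be arbitrarily large [x] with few primes
   in (x, a x]; there the deficits have small total weight, so some stretch
   (z, B z] carries almost none of it, while every (y, b y] inside that stretch
   has primes. *)
Lemma dense_ratio_step (a h : R) : 1 < h -> 1 + 8 * (h - 1) <= a ->
  dense_ratio (a * h) -> dense_ratio a.
Proof.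
move=> h1 ah [d0 d00 [X X1 dens]]; apply: contrapT => nd.
have u0 : 0 < h - 1 by lra.
have a1 : 1 < a by lra.
have a0 : 0 < a by lra. have h0 : 0 < h by lra.
have a1' : 1 <= a by lra.
set b := a * h in dens; have b1 : 1 < b by rewrite /b; nra.
have b0 : 0 < b by lra.
(* 100 is the range of t in [double_density_absurd]; the factor b leaves room for a whole interval
   (y, b y]. *)
pose B := 100 * b; have B1 : 1 < B by rewrite /B; lra.
have B0 : 0 < B by lra.
have lB : 0 < ln B by rewrite ln_gt0.
pose kap := (h - 1) / 4; have kap0 : 0 < kap by rewrite /kap; lra.
pose tau := kap * d0 / b / 2.
have tau0 : 0 < tau by rewrite /tau !divr_gt0 // mulr_gt0.
have tauE : tau < kap * d0 / b.
  have q : 0 < kap * d0 / b by rewrite divr_gt0 // mulr_gt0.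
  by rewrite /tau; lra.
(* The bound kap serves the density argument; the other, added to the density tau / (4 ln B) allowed
   on (x, a x], gives the tau / (2 ln B) of [stretch_count]. *)
pose e := Num.min kap (tau / (4 * ln B)).
have t4 : 0 < tau / (4 * ln B) by rewrite divr_gt0 // mulr_gt0.
have e0 : 0 < e by rewrite /e lt_min kap0.
have ekap : e <= kap by rewrite /e ge_min lexx.
have etau : e <= tau / (4 * ln B) by rewrite /e ge_min lexx orbT.
have [Y0 Y01 upper0] := Psi_window_le a1' e0.
pose Y := Num.max Y0 (1000 ^+ 2).
have YY0 : Y0 <= Y by rewrite /Y le_max lexx.
have Y6 : 1000 ^+ 2 <= Y by rewrite /Y le_max lexx orbT.
have Y1 : 1 <= Y := le_trans Y01 YY0.
have Yp : 0 < Y := lt_le_trans ltr01 Y1.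
have upper x x' : Y <= x -> x <= x' -> x' <= a * x -> Psi x' - Psi x <= 2 * (x' - x) + e * x.
  by move=> Yx; apply: upper0; exact: le_trans YY0 Yx.
have [C0 defsum] := deficit_sum a1' e0 Y1.
pose C := Num.max C0 0.
have C0C : C0 <= C by rewrite /C le_max lexx.
have Cp : 0 <= C by rewrite /C le_max lexx orbT.
pose Z := X * Y; have Z1 : 1 <= Z by rewrite /Z mulr_ege1.
pose L := 2 * (C + tau) * ln B / tau + 2 * ln Z.
pose x1 := Num.max (expR (L + 1)) Z.
have x11 : 1 <= x1 by rewrite /x1 le_max Z1 orbT.
have [x xx1 bad] := not_dense_ratio nd t4 x11.
have Zx : Z <= x by apply: le_trans xx1; rewrite /x1 le_max lexx orbT.
have x0 : 0 < x := lt_le_trans ltr01 (le_trans Z1 Zx).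
have Xp : 0 < X := lt_le_trans ltr01 X1.
have Lx : L < ln x.
  have : expR (L + 1) <= x by apply: le_trans xx1; rewrite /x1 le_max lexx.
  by rewrite -ler_ln ?posrE ?expR_gt0 // expRK; lra.
have eE : e + tau / (4 * ln B) <= tau / (2 * ln B).
  have -> : tau / (2 * ln B) = tau / (4 * ln B) + tau / (4 * ln B).
    by field; rewrite gt_eqF.
  by rewrite lerD2r.
have [I XI Ibig] := stretch_count Z1 B1 tau0 Cp eE Zx Lx.
have Yx : Y <= x by apply: le_trans Zx; rewrite /Z ler_peMl // (ltW Yp).
have tot := defsum _ _ Yx bad.
have XIY : X * B ^+ I <= x / Y by rewrite ler_pdivlMr // mulrAC.
have lenI : (tr (X * B ^+ I) <= tr (x / Y))%N by exact: le_truncn.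
have d_ge0 k : (0 < k)%N -> k%:R <= x / Y -> 0 <= deficit a e x k.
  by move=> k0 kx; apply: (deficit_ge0 a1' Y1 upper x0 k0 kx).
have f_ge0 k : (0 < k)%N -> k%:R <= x / Y -> 0 <= Lambda k / k%:R * deficit a e x k.
  by move=> k0 kx; rewrite mulr_ge0 ?d_ge0 // divr_ge0 ?vonMangoldt_ge0.
have [i iI small] : exists2 i, (i < I)%N &
    \sum_((tr (X * B ^+ i)).+1 <= k < (tr (X * B ^+ i.+1)).+1)
      Lambda k / k%:R * deficit a e x k <= tau.
  apply: contrapT => none.
  have : I%:R * tau <= \sum_(1 <= k < (tr (X * B ^+ I)).+1) Lambda k / k%:R * deficit a e x k.
    apply: stretch_pigeonhole => // [|k k0 kI|i iI]; first exact: ltW.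
      by apply: f_ge0 => //; exact: le_trans kI XIY.
    by rewrite leNgt; apply/negP => /ltW h'; apply: none; exists i.
  apply/negP; rewrite -ltNge.
  apply: (le_lt_trans (y := \sum_(1 <= k < (tr (x / Y)).+1) Lambda k / k%:R * deficit a e x k)).
    rewrite [X in _ <= X](@big_cat_nat _ _ _ (tr (X * B ^+ I)).+1) //= lerDl.
    rewrite big_nat; apply: sumr_ge0 => k /andP[k1 k2]; apply: f_ge0.
      exact: leq_trans k1.
    by rewrite -truncn_ge_nat // divr_ge0 // ltW.
  apply: (le_lt_trans tot); apply: le_lt_trans Ibig; lra.
pose z := X * B ^+ i.
have Bi1 : 1 <= B ^+ i by rewrite exprn_ege1 // ltW.
have Xz : X <= z by rewrite /z ler_peMr // ltW.
have z0 : 0 < z := lt_le_trans Xp Xz.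
have zE : X * B ^+ i.+1 = B * z by rewrite /z exprS; ring.
rewrite zE -/z in small.
have BzI : B * z <= x / Y.
  apply: le_trans XIY; rewrite -zE ler_pM2l // ler_eXn2l //.
have Bz0 : 0 < B * z by rewrite mulr_gt0.
have g_ge0 k : z < k%:R <= B * z -> 0 <= deficit a e x k.
  move=> /andP[k1 k2]; apply: d_ge0; last exact: le_trans k2 BzI.
  by rewrite -(ltr0n R); exact: lt_trans z0 k1.
apply: (@double_density_absurd a h e Y (x / (B * z)) h1 ah Y6) => //.
  by rewrite ler_pdivlMr // mulrC -ler_pdivlMr.
(* For k in (y, b y] the point v = x / k falls in [t, b t), and a small deficit at k is a density
   near 2 on (v, a v]. *)
move=> t t1 t2; pose y := x / (b * t).
have t0 : 0 < t by apply: lt_le_trans t1; rewrite divr_gt0.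
have bt0 : 0 < b * t by rewrite mulr_gt0.
have y0 : 0 < y by rewrite divr_gt0.
have byE : b * y = x / t by rewrite /y; field; rewrite !gt_eqF.
have zy : z <= y.
  rewrite /y ler_pdivlMr //; move: t2.
  have -> : 100 * (x / (B * z)) = x / (b * z) by rewrite /B; field; rewrite !gt_eqF.
  have -> : z * (b * t) = t * (b * z) by ring.
  by rewrite ler_pdivlMr // mulr_gt0.
have byz : b * y <= B * z.
  by rewrite byE ler_pdivrMr // mulrC -ler_pdivrMr.
have yby : y <= b * y by rewrite ler_peMl // ltW.
have [k /andP[k1 k2] dk] := window_small_deficit z0 b0 kap0 zy byz yby
  (dens _ (le_trans Xz zy)) tauE g_ge0 small.
have k0 : 0 < k%:R :> R := lt_trans y0 k1.
exists (x / k%:R).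
  apply/andP; split.
    by rewrite ler_pdivlMr // mulrC -ler_pdivlMr // -byE.
  by rewrite -/b ltr_pdivrMr // mulrC -ltr_pdivrMr.
have v0 : 0 < x / k%:R by rewrite divr_gt0.
move: dk; rewrite /deficit -(mulrA a x) -[k%:R / x]invf_div.
set v := x / k%:R in v0 *; set P := _ - Psi v.
move=> dk; have : 2 * (a - 1) + e - kap <= P / v by rewrite lerBlDr -lerBlDl.
rewrite ler_pdivlMr // => h2; apply: le_trans h2.
by rewrite ler_pM2r // -/kap lerD2r lerDl ltW.
Qed.

(** Descent from e^29 by the factor h = c^(1/8): the passage from h^(M+1) to h^M needs h^M >= 1 + 8
    (h - 1), which Bernoulli's inequality grants for M >= 8, and h^8 = c. *)
Lemma dense_ratio_gt1 (c : R) : 1 < c -> dense_ratio c.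
Proof.
move=> c1; pose h := expR (ln c / 8).
have lc : 0 < ln c by rewrite ln_gt0.
have h1 : 1 < h by rewrite -expR0 ltr_expR divr_gt0.
have h8 : h ^+ 8 = c.
  by rewrite -expRM_natl mulrC divfK ?pnatr_eq0 //; apply: lnK; rewrite posrE; lra.
have down M : dense_ratio (h ^+ (8 + M)) -> dense_ratio (h ^+ 8).
  elim: M => [|M IH]; first by rewrite addn0.
  rewrite addnS exprSr => D; apply: IH; apply: dense_ratio_step D => //.
  apply: le_trans (bernoulli_ge (8 + M) (ltW h1)); rewrite lerD2l ler_pM2r ?subr_gt0 //.
  by rewrite ler_nat leq_addr.
rewrite -h8; apply: (down (tr (expR 29 / (h - 1))).+1).
apply: dense_ratio_mono dense_ratio_exp.
apply: le_trans (bernoulli_ge _ (ltW h1)); set n := (8 + _)%N.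
have hn : expR 29 / (h - 1) < n%:R.
  apply: (lt_le_trans (truncnS_gt _)); by rewrite ler_nat leq_addl.
rewrite ltr_pdivrMr ?subr_gt0 // in hn.
by move: hn; set w := _ * _; lra.
Qed.

End Erdos.

(** * From prime powers to primes *)

Section PrimesInShortIntervals.
Context {R : realType}.
Implicit Types n m k p N M : nat.
Implicit Types x y z t : R.

Local Notation Lambda := (@vonMangoldt R).
Local Notation Psi := (@Psi R).
Local Notation tr := Num.truncn.

Lemma sum_prime_powers_le p N : prime p ->
  \sum_(1 <= k < N.+1 | (1 < k)%N && (p ^ k <= N)%N) ln p%:R <=
  (p * p <= N)%:R * ln N%:R :> R.
Proof.
move=> pp; have p1 := prime_gt1 pp; have p0 := ltnW p1.
have p0R : 0 < p%:R :> R by rewrite ltr0n.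
case: (leqP (p * p) N) => [ppN|Npp]; last first.
  rewrite mul0r big1 // => k /andP[k1 pk].
  have : (p ^ 2 <= p ^ k)%N by rewrite leq_exp2l.
  by move=> /leq_trans/(_ pk); rewrite leqNgt -mulnn Npp.
have N0 : (0 < N)%N by apply: leq_trans ppN; rewrite muln_gt0 p0.
rewrite mul1r.
apply: (@le_trans _ _ (\sum_(1 <= k < (trunc_log p N).+1) ln p%:R)).
  have lN : (trunc_log p N <= N)%N.
    by apply: ltnW; apply: leq_trans (trunc_logP p1 N0); exact: ltn_expl.
  rewrite [X in _ <= X](big_nat_widen _ _ N.+1) // big_mkcond [X in _ <= X]big_mkcond /=.
  apply: ler_sum => k _.
  have l0 : 0 <= ln p%:R :> R by rewrite ln_ge0 // ler1n.
  case: ifP => [/andP[k1 pk]|_]; last by case: ifP.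
  by rewrite ltnS trunc_log_max.
rewrite sumr_const_nat subSS subn0 -lnXn // -natrX.
rewrite ler_ln ?posrE ?ltr0n ?expn_gt0 ?p0 // ler_nat.
exact: trunc_logP.
Qed.

(** Only the primes p <= sqrt N have proper powers up to N, and each contributes at most ln N in
    all. *)
Lemma sum_vonMangoldt_nonprime N :
  \sum_(1 <= n < N.+1 | ~~ prime n) Lambda n <= Num.sqrt N%:R * ln N%:R.
Proof.
have [->|N0] := posnP N; first by rewrite big_geq // sqrtr0 mul0r.
have lN : 0 <= ln N%:R :> R by rewrite ln_ge0 // ler1n.
rewrite big_nat_cond.
under eq_bigr => n /andP[/andP[_ nN] _] do rewrite (vonMangoldtE (nN : (n <= N)%N)).
rewrite -big_nat_cond (exchange_big_dep prime) //=.
apply: (@le_trans _ _ (\sum_(1 <= p < N.+1 | prime p) (p * p <= N)%:R * ln N%:R)).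
  apply: ler_sum => p pp; apply: le_trans (sum_prime_powers_le N pp).
  rewrite (exchange_big_dep xpredT) //= [X in _ <= X]big_mkcond /= !big_nat.
  apply: ler_sum => k /andP[k0 _].
  have l0 : 0 <= ln p%:R :> R by rewrite ln_ge0 // ler1n prime_gt0.
  have [pk|pk] := leqP (p ^ k)%N N; last first.
    rewrite andbF big_nat_cond big1 // => n /andP[/andP[_ nN] /andP[_ /eqP e]].
    by move: pk; rewrite e ltnNge -ltnS nN.
  rewrite andbT.
  have e1 : \sum_(1 <= n < N.+1 | (~~ prime n && prime p) && (p ^ k == n)%N) ln p%:R <=
      (~~ prime (p ^ k))%:R * ln p%:R :> R.
    rewrite (big_rem (p ^ k)%N) /=; last first.
      by rewrite mem_index_iota expn_gt0 prime_gt0 //= ltnS.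
    rewrite big1_seq ?addr0 => [|n].
      by case: (prime (p ^ k)); rewrite /= ?mul0r // mul1r; case: ifP.
    rewrite mem_rem_uniq ?iota_uniq // => /andP[/andP[_ /eqP <-]].
    by rewrite inE eqxx.
  apply: (le_trans e1); case: k k0 {e1 pk} => [|[|k]] // _ /=.
  - by rewrite expn1 pp mul0r.
  - by rewrite ler_piMl // lern1 leq_b1.
rewrite -mulr_suml ler_wpM2r //.
apply: (@le_trans _ _ (\sum_(1 <= p < N.+1) (p * p <= N)%:R)).
  by rewrite big_mkcond; apply: ler_sum => p _; case: ifP.
have s0 : 0 <= Num.sqrt N%:R :> R by rewrite sqrtr_ge0.
have -> : \sum_(1 <= p < N.+1) (p * p <= N)%:R =
    \sum_(1 <= p < N.+1 | (p < (tr (Num.sqrt (N%:R : R))).+1)%N) 1 :> R.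
  rewrite [RHS]big_mkcond; apply: eq_bigr => p _.
  have -> : (p < (tr (Num.sqrt (N%:R : R))).+1)%N = (p * p <= N)%N.
    rewrite ltnS truncn_ge_nat // -(ler_nat R) natrM -expr2.
    by rewrite -[in RHS](sqr_sqrtr (ler0n R N)) ler_pXn2r ?nnegrE.
  by case: (p * p <= N)%N.
rewrite -(big_nat_widen 1 (tr (Num.sqrt (N%:R : R))).+1 N.+1 xpredT (fun=> 1)); last first.
  rewrite ltnS -(ler_nat R); have h : (tr (Num.sqrt (N%:R : R)))%:R <= Num.sqrt (N%:R : R).
    by rewrite truncn_le.
  apply: (le_trans h).
  have s1 : 1 <= Num.sqrt (N%:R : R) by rewrite -[X in X <= _]sqrtr1 ler_wsqrtr // ler1n.
  rewrite -[X in _ <= X](sqr_sqrtr (ler0n R N)) expr2 ler_peMl //.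
by rewrite sumr_const_nat subSS subn0 truncn_le.
Qed.

(** Without primes, (x, c x] carries at most sqrt (c x) ln (c x). With w^4 = c x this is at most 4
    w^3, while density demands (e / c) w^4; hence w <= 4 c / e = q, excluded by x >= q^4. *)
Lemma prime_in_short_interval (c : R) : 1 < c ->
  exists X : R, forall x, X <= x -> exists2 p, prime p & x < p%:R <= c * x.
Proof.
move=> c1; have [e e0 [X X1 dens]] := dense_ratio_gt1 c1.
have c0 : 0 < c by lra.
pose q := 4 * c / e; have q0 : 0 < q by rewrite /q divr_gt0 // mulr_gt0.
exists (Num.max X ((q ^+ 2) ^+ 2)) => x; rewrite ge_max => /andP[Xx qx].
have x0 : 0 < x by lra.
have xcx : x <= c * x by rewrite ler_peMl // ltW.
apply: contrapT => none.
have := dens x Xx; rewrite Psi_sub // => h.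
pose s := Num.sqrt (c * x).
have cx0 : 0 < c * x by rewrite mulr_gt0.
have s0 : 0 < s by rewrite sqrtr_gt0.
have ss : s * s = c * x by rewrite -expr2 sqr_sqrtr // ltW.
pose w := Num.sqrt s; have w0 : 0 < w by rewrite sqrtr_gt0.
have ww : w * w = s by rewrite -expr2 sqr_sqrtr // ltW.
have lw : ln (c * x) <= 4 * w.
  by rewrite ln_sqrt // -/s; have := ln_le_sqrt s0; rewrite -/w; lra.
have tcx : (tr (c * x))%:R <= c * x by rewrite truncn_le ltW.
have cx1 : 1 <= c * x by lra.
have up : \sum_((tr x).+1 <= k < (tr (c * x)).+1) Lambda k <= s * (4 * w).
  apply: (@le_trans _ _ (\sum_(1 <= k < (tr (c * x)).+1 | ~~ prime k) Lambda k)).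
    rewrite [X in _ <= X]big_mkcond.
    rewrite (@big_cat_nat _ _ _ (tr x).+1 1 (tr (c * x)).+1) //=; last first.
      by rewrite ltnS le_truncn.
    rewrite -[X in X <= _]add0r lerD //.
      by apply: sumr_ge0 => k _; case: ifP => // _; exact: vonMangoldt_ge0.
    rewrite !big_nat; apply: ler_sum => k; rewrite truncn_window ?(ltW x0) ?(ltW cx0) // => hk.
    by case: ifP => // /negbFE pk; case: none; exists k.
  apply: (le_trans (sum_vonMangoldt_nonprime _)).
  apply: ler_pM; rewrite ?sqrtr_ge0 //.
  - by rewrite ln_ge0 // ler1n truncn_gt0.
  - exact: ler_wsqrtr.
  - by apply: le_trans lw; exact: ln_truncn_le.
have h2 : e * x <= s * (4 * w) by lra.
have qw : q < w.
  rewrite ltNge; apply/negP => wq.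
  have wq2 : w * w <= q ^+ 2 by rewrite -expr2 ler_pXn2r // nnegrE ltW.
  have : s * s <= (q ^+ 2) ^+ 2.
    by rewrite -expr2 ler_pXn2r ?nnegrE ?sqr_ge0 ?(ltW s0) // -ww.
  have : x < c * x by rewrite ltr_pMl.
  lra.
have h3 : e * (s * s) <= c * (s * (4 * w)) by rewrite ss mulrCA ler_pM2l.
have qe : q * e = 4 * c by rewrite /q divfK ?gt_eqF.
have h4 : q * (e * s * w) < w * (e * s * w) by rewrite ltr_pM2r // !mulr_gt0.
have h5 : w * (e * s * w) = e * (s * s) by rewrite -{2}ww; ring.
have h6 : q * (e * s * w) = c * (s * (4 * w)).
  by transitivity (q * e * (s * w)); [ring|rewrite qe; ring].
by lra.
Qed.

End PrimesInShortIntervals.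

(** * Sidon sets *)

Lemma eqn_mod_pos (N a b : nat) : (0 < a <= N)%N -> (0 < b <= N)%N ->
  a = b %[mod N] -> a = b.
Proof.
case: a => // i /=; case: b => // j /= iN jN /eqP.
by rewrite -addn1 -(addn1 j) eqn_modDr !modn_small // => /eqP ->.
Qed.

Section BoseChowla.
Context (d : nat) (K : finFieldType) (theta : {unit K}).
Hypotheses (d_prime : prime d) (cardK : #|K| = (d ^ 2)%N).
Hypothesis gen_theta : generator [set: {unit K}] theta.

Local Notation N := (d ^ 2).-1.
Local Notation A := (bose_chowla d theta).

Let char_d : d \in [pchar K] := card_finPcharP cardK d_prime.

Let d_gt1 : (1 < d)%N := prime_gt1 d_prime.

Lemma order_theta : #[theta]%g = N.
Proof. by rewrite /order -(eqP gen_theta) card_finField_unit cardK. Qed.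

Lemma expr_theta_eq i j :
  (val theta ^+ i == val theta ^+ j) = (i == j %[mod N])%N.
Proof.
by rewrite -order_theta -eq_expg_mod_order -!FinRing.val_unitX (inj_eq val_inj).
Qed.

(** Stands for membership in F_d; closure under the field operations is immediate in this form. *)
Definition frob_fixed (x : K) := x ^+ d == x.

Lemma frob_fixedD x y : frob_fixed x -> frob_fixed y -> frob_fixed (x + y).
Proof.
rewrite /frob_fixed => /eqP hx /eqP hy; apply/eqP.
by rewrite -(pFrobenius_autE char_d) pFrobenius_autD_comm ?pFrobenius_autE ?hx ?hy //; exact: mulrC.
Qed.

Lemma frob_fixedN x : frob_fixed x -> frob_fixed (- x).
Proof.
rewrite /frob_fixed => /eqP hx; apply/eqP.
by rewrite -(pFrobenius_autE char_d) pFrobenius_autN pFrobenius_autE hx.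
Qed.

Lemma frob_fixedM x y : frob_fixed x -> frob_fixed y -> frob_fixed (x * y).
Proof. by rewrite /frob_fixed exprMn => /eqP -> /eqP ->. Qed.

Lemma frob_fixedV x : frob_fixed x -> frob_fixed x^-1.
Proof. by rewrite /frob_fixed exprVn => /eqP ->. Qed.

Lemma frob_fixed_codom x : x \in codom (fun c : 'F_d => c%:R : K) -> frob_fixed x.
Proof.
by case/codomP => c ->; rewrite /frob_fixed -(pFrobenius_autE char_d) pFrobenius_aut_nat.
Qed.

(** Otherwise d would be congruent to 1 modulo d^2 - 1, whereas 1 < d < d^2 - 1. *)
Lemma theta_not_fixed : ~~ frob_fixed (val theta).
Proof.
rewrite /frob_fixed -{2}(expr1 (val theta)) expr_theta_eq.
have d4 : (4 <= d ^ 2)%N by rewrite -[4%N]/(2 ^ 2)%N leq_exp2r.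
have dd : (d < d ^ 2 - 1)%N by rewrite -mulnn; nia.
rewrite -subn1 !modn_small //; last by lia.
by rewrite gtn_eqF.
Qed.

Lemma bose_chowlaP (a : 'I_(d ^ 2)) : a \in A ->
  (1 <= a)%N /\ frob_fixed (val theta ^+ a - val theta).
Proof. by rewrite inE => /andP[a1 /frob_fixed_codom]. Qed.

Lemma bose_chowla_inj (a b : 'I_(d ^ 2)) : a \in A -> b \in A ->
  val theta ^+ a = val theta ^+ b -> a = b.
Proof.
move=> /bose_chowlaP[a1 _] /bose_chowlaP[b1 _] /eqP.
rewrite expr_theta_eq => /eqP ab; apply: val_inj; apply: eqn_mod_pos ab.
  by rewrite a1 /= -ltnS (ltn_predK (ltn_ord a)) ltn_ord.
by rewrite b1 /= -ltnS (ltn_predK (ltn_ord a)) ltn_ord.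
Qed.

(** Each theta^a is theta plus an element of F_d, so the two products differ by a linear expression
    in theta over F_d. As theta is not in F_d, both its coefficients vanish, which yields (ca -
    ca')(ca - cb) = 0. *)
Lemma bose_chowla_sidon (a b a' b' : 'I_(d ^ 2)) :
  a \in A -> b \in A -> a' \in A -> b' \in A -> a != b ->
  a + b' = a' + b %[mod N] -> a = a'.
Proof.
move=> Aa Ab Aa' Ab' ab /eqP; rewrite -expr_theta_eq !exprD => /eqP.
have [_ fa] := bose_chowlaP Aa; have [_ fb] := bose_chowlaP Ab.
have [_ fa'] := bose_chowlaP Aa'; have [_ fb'] := bose_chowlaP Ab'.
have tE x : val theta ^+ x = val theta + (val theta ^+ x - val theta) by rewrite addrC subrK.
rewrite (tE a) (tE b) (tE a') (tE b').
move: fa fb fa' fb'; set ca := val theta ^+ a - _; set cb := val theta ^+ b - _.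
set ca' := val theta ^+ a' - _; set cb' := val theta ^+ b' - _.
move=> fa fb fa' fb' E.
have E1 : (ca + cb' - ca' - cb) * val theta = ca' * cb - ca * cb'.
  apply/eqP; rewrite -subr_eq0; apply/eqP.
  transitivity ((val theta + ca) * (val theta + cb') - (val theta + ca') * (val theta + cb)).
    by ring.
  by rewrite E subrr.
have s0 : ca + cb' - ca' - cb = 0.
  apply: contraNeq theta_not_fixed => s0.
  have -> : val theta = (ca + cb' - ca' - cb)^-1 * (ca' * cb - ca * cb') by rewrite -E1 mulKf.
  by do ![assumption | apply: frob_fixedM | apply: frob_fixedV
         | apply: frob_fixedD | apply: frob_fixedN].
have p0 : (ca - ca') * (ca - cb) = 0.
  have e0 : ca' * cb - ca * cb' = 0 by rewrite -E1 s0 mul0r.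
  transitivity (ca * (ca + cb' - ca' - cb) + (ca' * cb - ca * cb')); first by ring.
  by rewrite s0 e0 mulr0 addr0.
move/eqP: p0; rewrite mulf_eq0 !subr_eq0 => /orP[] /eqP e.
  by apply: bose_chowla_inj => //; rewrite tE -/ca e /ca' -tE.
case/eqP: ab; apply: bose_chowla_inj => //.
by rewrite tE -/ca e /cb -tE.
Qed.

Lemma natF_inj : injective (fun c : 'F_d => c%:R : K).
Proof.
move=> c c' /eqP.
have lt (x : 'F_d) : (x < d)%N by have := ltn_ord x; rewrite [X in (_ < X)%N]Fp_cast.
wlog cc : c c' / (c' <= c)%N => [H|].
  by have [/H//|/ltnW h] := leqP c' c; rewrite eq_sym => /H -> //.
rewrite -subr_eq0 -natrB // -(dvdn_pcharf char_d) => dv.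
apply: val_inj => /=; apply/eqP; rewrite eqn_leq cc andbT -subn_eq0.
apply: contraLR dv => h; rewrite gtnNdvd //; first by rewrite lt0n.
by rewrite (leq_ltn_trans (leq_subr _ _)).
Qed.

(** The map from a to theta^a - theta is a bijection onto F_d: for x in F_d, theta + x is nonzero,
    hence a power of theta. *)
Lemma card_bose_chowla : #|A| = d.
Proof.
pose C := [set x : K | x \in codom (fun c : 'F_d => c%:R : K)].
have cardC : #|C| = d.
  by rewrite cardsE (card_codom natF_inj) card_Fp.
have inj : {in A &, injective (fun a : 'I_(d ^ 2) => val theta ^+ a - val theta)}.
  by move=> a b Aa Ab /addIr; exact: bose_chowla_inj.
transitivity #|[set val theta ^+ a - val theta | a : 'I_(d ^ 2) in A]|.
  by rewrite card_in_imset.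
rewrite -[RHS]cardC; apply: eq_card => x.
apply/imsetP/idP => [[a Aa ->]|].
  by move: Aa; rewrite /C in_set => /andP[_ h]; rewrite in_set.
rewrite /C in_set => Cx; have fx := frob_fixed_codom Cx.
have nz : val theta + x != 0.
  by apply: contraNneq theta_not_fixed => /eqP; rewrite addr_eq0 => /eqP ->; exact: frob_fixedN.
have u : val theta + x \is a GRing.unit by rewrite unitfE.
have : FinRing.unit K u \in <[theta]>%g by rewrite -(eqP gen_theta) inE.
case/cyclePmin => i; rewrite order_theta => iN /(congr1 val).
rewrite FinRing.val_unitX /= => E.
(* Exponents in A are positive, so exponent 0 is replaced by d^2 - 1. *)
have [i0|i0] := posnP i.
  have d2 : (N < d ^ 2)%N by rewrite ltn_predL expn_gt0 prime_gt0.
  have xE : val theta ^+ N - val theta = x.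
    have -> : val theta ^+ N = 1.
      by rewrite -order_theta -FinRing.val_unitX expg_order.
    by rewrite i0 expr0 in E; rewrite -E (addrC _ x) addrK.
  exists (Ordinal d2); last by rewrite /= xE.
  by rewrite in_set /= xE Cx andbT -order_theta order_gt0.
have id2 : (i < d ^ 2)%N by apply: leq_trans iN (leq_pred _).
exists (Ordinal id2); last by rewrite /= -E (addrC _ x) addrK.
by rewrite in_set /= i0 -E (addrC _ x) addrK Cx.
Qed.

End BoseChowla.

(** * The Erdos-Turan bound for Sidon sets in an interval *)

Section ErdosTuran.
Local Open Scope nat_scope.

Lemma sum_sqr_Cauchy M (f : 'I_M -> nat) :
  (\sum_(w < M) f w) ^ 2 <= M * \sum_(w < M) f w ^ 2.
Proof.
rewrite -(leq_pmul2l (m := 2)) // -mulnn big_distrlr /= big_distrr /=.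
apply: (@leq_trans (\sum_(i < M) \sum_(j < M) (f i ^ 2 + f j ^ 2))).
  apply: leq_sum => i _; rewrite big_distrr /=; apply: leq_sum => j _.
  exact: nat_Cauchy.
rewrite [X in X <= _](eq_bigr (fun i => M * f i ^ 2 + \sum_(j < M) f j ^ 2)); last first.
  by move=> i _; rewrite big_split /= sum_nat_const card_ord.
by rewrite big_split /= -big_distrr /= sum_nat_const card_ord mul2n addnn.
Qed.

Lemma sum_window M a u : a + u <= M -> \sum_(w < M) (a <= w < a + u : nat) = u.
Proof.
move=> au; rewrite -(big_mkord xpredT (fun w => (a <= w < a + u : nat))).
rewrite (@big_cat_nat _ _ _ a) ?(leq_trans (leq_addr u a)) //=.
rewrite [X in _ + X](@big_cat_nat _ _ _ (a + u)) ?leq_addr //=.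
rewrite [X in X + _]big_nat_cond [X in X + _]big1 => [|i /andP[/andP[_ ia] _]]; last first.
  by rewrite leqNgt ia.
rewrite [X in _ + (_ + X)]big_nat_cond.
rewrite [X in _ + (_ + X)]big1 => [|i /andP[/andP[ia _] _]]; last first.
  by rewrite [i < _]ltnNge ia andbF.
rewrite add0n addn0 big_nat.
under eq_bigr => i hi do rewrite hi.
by rewrite -big_nat sum_nat_const_nat muln1 addKn.
Qed.

(* Each window of length u meets J(P) in f(w) points; sum f and sum f^2 are
   compared by Cauchy-Schwarz, and a pair (x, y) with x <> y and a window
   containing both are determined by the offsets (w - J x, w - J y). *)
Lemma erdos_turan (X : finType) (P : {set X}) (J : X -> nat) L u : 0 < u ->
  {in P, forall x, J x < L} ->
  (forall x y x' y', x \in P -> y \in P -> x' \in P -> y' \in P -> x != y ->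
     J x + J y' = J x' + J y -> x = x') ->
  #|P| ^ 2 * u <= (L + u) * (#|P| + u).
Proof.
case: u => // u _ JL sid; set v := u.+1.
have Jinj : {in P &, injective J}.
  move=> y y' Py Py' E; have [//|ne] := eqVneq y y'.
  by apply: (sid y y' y' y); rewrite ?E.
pose g x w : nat := (J x <= w < J x + v).
pose f (w : 'I_(L + v)) := \sum_(x in P) g x w.
have gsum x : x \in P -> \sum_(w < L + v) g x w = v.
  by move=> Px; apply: sum_window; rewrite leq_add2r ltnW // JL.
have s1 : \sum_(w < L + v) f w = #|P| * v.
  by rewrite exchange_big /= (eq_bigr _ gsum) sum_nat_const.
have s2 : \sum_(w < L + v) f w ^ 2 <= #|P| * v + v ^ 2.
  have -> : \sum_(w < L + v) f w ^ 2 =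
      \sum_(x in P) \sum_(y in P) \sum_(w < L + v) g x w * g y w.
    transitivity (\sum_(w < L + v) \sum_(x in P) \sum_(y in P) g x w * g y w).
      by apply: eq_bigr => w _; rewrite -mulnn big_distrlr.
    by rewrite exchange_big; apply: eq_bigr => x _; rewrite exchange_big.
  have -> : \sum_(x in P) \sum_(y in P) \sum_(w < L + v) g x w * g y w =
      #|P| * v + \sum_(x in P) \sum_(y in P | y != x) \sum_(w < L + v) g x w * g y w.
    rewrite -sum_nat_const -big_split /=; apply: eq_bigr => x Px.
    rewrite (bigD1 x) //=; congr (_ + _); rewrite -[RHS](gsum x Px).
    by apply: eq_bigr => w _; rewrite /g; case: (_ && _).
  rewrite leq_add2l.
  pose T := [set t : X * X * 'I_(L + v) | [&& t.1.1 \in P, t.1.2 \in P,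
     t.1.2 != t.1.1, J t.1.1 <= t.2 < J t.1.1 + v & J t.1.2 <= t.2 < J t.1.2 + v]].
  have -> : \sum_(x in P) \sum_(y in P | y != x) \sum_(w < L + v) g x w * g y w = #|T|.
    rewrite pair_big_dep /= pair_big_dep /= -sum1_card big_mkcond [RHS]big_mkcond /=.
    apply: eq_bigr => -[[x y] w] _; rewrite inE /= /g.
    by do !case: (_ \in _) => //=; case: (_ != _) => //=; do 2!case: (_ <= _ < _).
  have -> : v ^ 2 = #|{: 'I_v * 'I_v}| by rewrite card_prod !card_ord -mulnn.
  pose h (t : X * X * 'I_(L + v)) : 'I_v * 'I_v := (inord (t.2 - J t.1.1), inord (t.2 - J t.1.2)).
  apply: (leq_trans _ (max_card (mem (h @: T)))).
  rewrite card_in_imset // => -[[x y] w] [[x' y'] w']; rewrite !inE /=.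
  move=> /and5P[Px Py yx hx hy] /and5P[Px' Py' yx' hx' hy'] /=.
  case=> /(congr1 val) /= e1 /(congr1 val) /= e2; move: e1 e2.
  rewrite !inordK; try lia.
  move=> e1 e2; have xx' : x = x'.
    by apply: (sid x y x' y') => //; [rewrite eq_sym|lia].
  have yy' : y = y' by apply: Jinj => //; subst; lia.
  by subst; congr (_, _); apply: val_inj => /=; lia.
have := sum_sqr_Cauchy f; rewrite s1 => /leq_trans h.
have {s2}h : (#|P| * v) ^ 2 <= (L + v) * (#|P| * v + v ^ 2).
  by apply: h; rewrite leq_mul2l s2 orbT.
rewrite -(leq_pmul2r (m := v)) //.
have -> : #|P| ^ 2 * v * v = (#|P| * v) ^ 2 by rewrite expnMn -mulnA mulnn.
have -> // : (L + v) * (#|P| + v) * v = (L + v) * (#|P| * v + v ^ 2).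
by rewrite -mulnA [(_ + v) * v]mulnDl -mulnn.
Qed.

End ErdosTuran.

(** * Products in the cyclic ring *)

Section Rings.
Context (q k : nat).
Import Pdiv.CommonRing Pdiv.RingMonic.

Local Notation n := k.+1.
Local Notation cyc := (cyc_poly q k).
Local Notation ones := (all_one_poly q k).
Local Notation Rn := (cyc_ring q k).
Local Notation Fk := (Fqk q k).

Lemma size_cyc_poly : size cyc = n.+1.
Proof. by rewrite size_XnsubC. Qed.

Lemma size_cyc_ring (y : Rn) : (size (y : {poly 'F_q}) <= n)%N.
Proof.
rewrite -ltnS; apply: leq_trans (size_mk_monic y) _.
by rewrite mk_monic_cyc_poly size_cyc_poly.
Qed.

Lemma in_cyc_Xn_mod b : in_qpoly cyc 'X^b = in_qpoly cyc 'X^(b %% n).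
Proof.
have X1 : in_qpoly cyc 'X^n = 1.
  apply/eqP; rewrite -subr_eq0 -in_qpoly1 -raddfB /=; apply/eqP; apply: val_inj => /=.
  by rewrite mk_monic_cyc_poly; apply: rmodpp; rewrite monicXnsubC.
rewrite {1}(divn_eq b n) exprD in_qpolyM mulnC exprM.
by rewrite rmorphXn /= X1 expr1n mul1r.
Qed.

Lemma coef_in_cyc_Xn b i : (b < n)%N -> (in_qpoly cyc 'X^b : {poly 'F_q})`_i = (i == b)%:R.
Proof.
move=> bn; rewrite in_qpoly_small ?coefXn //.
by rewrite mk_monic_cyc_poly size_cyc_poly size_polyXn.
Qed.

Lemma cyc_ringE (f : Rn) :
  f = \sum_(j < n) (f : {poly 'F_q})`_j *: in_qpoly cyc 'X^j.
Proof.
apply: val_inj => /=; rewrite poly_of_qpoly_sum; apply/polyP => i.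
rewrite coef_sum; under eq_bigr => j _ do rewrite poly_of_qpolyZ coefZ coef_in_cyc_Xn //.
have [iN|iN] := ltnP i n; last first.
  rewrite nth_default ?(leq_trans (size_cyc_ring f)) // big1 // => j _.
  by rewrite gtn_eqF ?mulr0 // (leq_trans (ltn_ord j)).
rewrite (bigD1 (Ordinal iN)) //= eqxx mulr1 big1 ?addr0 // => j ji.
by rewrite eq_sym (negbTE (ji : val j != i)) mulr0.
Qed.

Lemma coef_cyc_mul (f y : Rn) i :
  (f * y : {poly 'F_q})`_i =
  \sum_(j < n) \sum_(l < n | ((j + l) %% n == i)%N)
     (f : {poly 'F_q})`_j * (y : {poly 'F_q})`_l.
Proof.
rewrite {1}(cyc_ringE f) {1}(cyc_ringE y) mulr_suml poly_of_qpoly_sum coef_sum.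
apply: eq_bigr => j _; rewrite mulr_sumr poly_of_qpoly_sum coef_sum [RHS]big_mkcond.
apply: eq_bigr => l _.
rewrite -scalerAl -scalerAr scalerA -in_qpolyM -exprD in_cyc_Xn_mod.
rewrite poly_of_qpolyZ coefZ coef_in_cyc_Xn ?ltn_pmod // eq_sym.
by case: ifP; rewrite ?mulr1 ?mulr0.
Qed.

Lemma all_one_polyE : ones = \poly_(i < n) 1.
Proof. by rewrite poly_def; apply: eq_bigr => i _; rewrite scale1r. Qed.

Lemma size_all_one_poly : size ones = n.
Proof. by rewrite all_one_polyE size_poly_eq ?oner_eq0. Qed.

Lemma monic_all_one_poly : ones \is monic.
Proof. by rewrite all_one_polyE monicE lead_coef_poly ?oner_eq0. Qed.

Lemma coef_all_one_poly i : (i <= k)%N -> ones`_i = 1.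
Proof. by move=> ik; rewrite all_one_polyE coef_poly ltnS ik. Qed.

(** Allows a product to be reduced modulo x^(k+1) - 1 first and modulo 1 + x + ... + x^k
    afterwards. *)
Lemma cyc_poly_factor : cyc = ('X - 1) * ones.
Proof. by rewrite /cyc_poly subrX1. Qed.

Lemma size_Fqk (f : Fk) : (0 < k)%N -> (size (f : {poly 'F_q}) <= k)%N.
Proof.
move=> k0; rewrite -ltnS; apply: leq_trans (size_mk_monic f) _.
by rewrite mk_monic_all_one_poly // size_all_one_poly.
Qed.

Lemma alpha_star_poly (N : nat) (A : {set 'I_N}) : (1 < k)%N -> (N <= k)%N ->
  (alpha_star q k A : {poly 'F_q}) = \sum_(a in A) 'X^a.
Proof.
move=> k1 Nk; rewrite /alpha_star poly_of_qpoly_sum; apply: eq_bigr => a _.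
rewrite poly_of_qpolyX qpolyXE ?monic_all_one_poly ?size_all_one_poly //.
rewrite rmodp_small // mk_monic_all_one_poly ?(ltnW k1) // size_all_one_poly.
by rewrite size_polyXn ltnS (leq_trans (ltn_ord a)).
Qed.

Lemma embed_poly (f : Fk) : (0 < k)%N -> (embed f : {poly 'F_q}) = f.
Proof.
move=> k0; apply: in_qpoly_small.
rewrite mk_monic_cyc_poly size_cyc_poly.
by rewrite ltnS (leq_trans (size_Fqk f k0)) // leqnSn.
Qed.

(* All coefficients of 1 + x + ... + x^k are 1: reducing [z] of degree at most k
   modulo it subtracts [z`_k] times it. *)
Lemma coef_Fqk_mul (x y : Fk) i : (0 < k)%N -> (i < k)%N ->
  (x * y : {poly 'F_q})`_i = (embed x * embed y : {poly 'F_q})`_i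
    - (embed x * embed y : {poly 'F_q})`_k.
Proof.
move=> k0 ik; set z : {poly 'F_q} := embed x * embed y.
have mc : cyc \is monic by rewrite monicXnsubC.
have zE : z = rmodp ((x : {poly 'F_q}) * y) cyc.
  by rewrite /z poly_of_qpolyM !embed_poly // mk_monic_cyc_poly.
have szz : (size z <= n)%N by exact: size_cyc_ring.
have -> : (x * y : {poly 'F_q}) = z - z`_k *: ones.
  rewrite poly_of_qpolyM.
  move: zE; set px : {poly 'F_q} := x; set py : {poly 'F_q} := y => zE.
  rewrite mk_monic_all_one_poly // [X in rmodp X _](rdivp_eq mc) -zE cyc_poly_factor mulrA.
  rewrite rmodpD ?monic_all_one_poly // rmodp_mull ?monic_all_one_poly // add0r.
  rewrite -[in LHS](subrK (z`_k *: ones) z) rmodpD ?monic_all_one_poly //.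
  rewrite rmodpZ ?monic_all_one_poly // rmodpp ?monic_all_one_poly // scaler0 addr0.
  apply: rmodp_small; rewrite size_all_one_poly ltnS; apply/leq_sizeP => j kj.
  rewrite coefB coefZ; have [jk|kj'] := leqP j k.
    have -> : j = k by apply/eqP; rewrite eqn_leq jk kj.
    by rewrite coef_all_one_poly // mulr1 subrr.
  rewrite nth_default ?(leq_trans szz) // all_one_polyE coef_poly ltnS leqNgt kj'.
  by rewrite mulr0 subrr.
by rewrite coefB coefZ coef_all_one_poly ?mulr1 // ltnW.
Qed.

End Rings.

(** * Counting the nonzero coefficients of the product in the window *)

Section Counting.
Context (q k M m : nat) (A : {set 'I_M}).
Hypotheses (k_gt1 : (1 < k)%N) (M_le : (M <= k)%N) (m_le : (m <= k.+1)%N).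
Hypothesis A_pos : forall a, a \in A -> (0 < a)%N.
Hypothesis A_sidon : forall a b a' b', a \in A -> b \in A -> a' \in A -> b' \in A ->
  a != b -> a + b' = a' + b %[mod M.-1] -> a = a'.

Local Notation n := k.+1.

Lemma ltn_A (a : 'I_M) : (a < n)%N.
Proof. by rewrite (leq_trans (ltn_ord a)) // leqW. Qed.

Definition cshift (s : 'I_n) (a : 'I_M) : 'I_n := inord ((s + a) %% n).

Lemma val_cshift s a : val (cshift s a) = ((s + a) %% n)%N.
Proof. by rewrite /= inordK // ltn_pmod. Qed.

Lemma cshift_inj s : injective (cshift s).
Proof.
move=> a b /(congr1 val); rewrite !val_cshift => /eqP; rewrite eqn_modDl.
by rewrite !modn_small ?ltn_A // => /eqP; exact: val_inj.
Qed.

Variable y : cyc_ring q k.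
Let z : cyc_ring q k := embed (alpha_star q k A) * y.
Let S := [set l : 'I_n | (y : {poly 'F_q})`_l != 0].

Lemma coef_alpha_mul i :
  (z : {poly 'F_q})`_i =
  \sum_(a in A) \sum_(l < n | ((a + l) %% n == i)%N) (y : {poly 'F_q})`_l.
Proof.
rewrite coef_cyc_mul embed_poly ?(ltnW k_gt1) // alpha_star_poly //.
under eq_bigr => j _ do under eq_bigr => l _ do rewrite coef_sum mulr_suml.
under eq_bigr => j _ do rewrite exchange_big.
rewrite exchange_big /=; apply: eq_bigr => a Aa.
rewrite (bigD1 (Ordinal (ltn_A a))) //= [X in _ + X]big1 ?addr0 => [|j ja].
  by apply: eq_bigr => l _; rewrite coefXn eqxx mul1r.
rewrite big1 // => l _; rewrite coefXn.
by rewrite (negbTE (ja : val j != a)) mul0r.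
Qed.

Lemma nonzero_coef_cshift (i : 'I_n) : (z : {poly 'F_q})`_i != 0 ->
  exists la : 'I_n * 'I_M, [/\ la.1 \in S, la.2 \in A & i = cshift la.1 la.2].
Proof.
rewrite coef_alpha_mul => nz.
have [/existsP[la /and3P[h1 h2 /eqP h3]]|none] :=
  boolP [exists la : 'I_n * 'I_M, [&& la.1 \in S, la.2 \in A & i == cshift la.1 la.2]].
  by exists la.
case/eqP: nz; rewrite big1 // => a Aa; rewrite big1 // => l /eqP e.
have [//|yl] := eqVneq ((y : {poly 'F_q})`_l) 0.
case/existsP: none; exists (l, a); rewrite inE yl Aa /=.
by apply/eqP; apply: val_inj; rewrite val_cshift addnC e.
Qed.

Let W := [set i : 'I_n | (i < m)%N && ((z : {poly 'F_q})`_i != 0)].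

Lemma card_low_le : (#|W| <= #|S| * #|A|)%N.
Proof.
rewrite -cardsX.
apply: (leq_trans _ (leq_imset_card (fun la : 'I_n * 'I_M => cshift la.1 la.2) _)).
apply: subset_leq_card; apply/subsetP => i; rewrite inE => /andP[_].
case/nonzero_coef_cshift => -[l a] /= [Sl Aa ->].
by apply/imsetP; exists (l, a); rewrite ?inE ?Aa ?andbT //; move: Sl; rewrite inE.
Qed.

Let collide s t := [set a in A | [exists a' in A, cshift s a == cshift t a']].

(* Two distinct shifts of A meet in at most two points: the difference a - a'
   is one of two given integers, and each has at most one representation. *)
Lemma card_collide s t : s != t -> (#|collide s t| <= 2)%N.
Proof.
move=> st.
pose Blt := [set a in A | [exists a' in A, (cshift s a == cshift t a') && (a < a')%N]].
pose Bgt := [set a in A | [exists a' in A, (cshift s a == cshift t a') && (a' < a)%N]].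
have mods a a' b b' : cshift s a = cshift t a' -> cshift s b = cshift t b' ->
    ((a + b') %% n = (a' + b) %% n)%N.
  move=> /(congr1 val) + /(congr1 val); rewrite !val_cshift => e1 e2.
  have : (s + a + (t + b') = (t + a') + (s + b) %[mod n])%N.
    by rewrite -modnDm e1 -e2 modnDm.
  have -> : (s + a + (t + b') = (s + t) + (a + b'))%N by lia.
  have -> : (t + a' + (s + b) = (s + t) + (a' + b))%N by lia.
  by move/eqP; rewrite eqn_modDl => /eqP.
have neq a a' : cshift s a = cshift t a' -> a != a'.
  move=> /(congr1 val); rewrite !val_cshift => e; apply: contraNneq st => aa.
  move/eqP: e; rewrite aa eqn_modDr !modn_small // => /eqP; exact: val_inj.
have sub : collide s t \subset Blt :|: Bgt.
  apply/subsetP => a; rewrite !inE => /andP[Aa /exists_inP[a' Aa' /eqP e]].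
  rewrite Aa /=; have := neq _ _ e; rewrite -(inj_eq val_inj) /= neq_ltn => /orP[h|h].
    by apply/orP; left; apply/exists_inP; exists a' => //; rewrite e eqxx.
  by apply/orP; right; apply/exists_inP; exists a' => //; rewrite e eqxx.
apply: (leq_trans (subset_leq_card sub)); apply: (leq_trans (leq_card_setU _ _)).
have lt1 : (#|Blt| <= 1)%N.
  apply/card_le1_eqP => a b; rewrite !inE.
  move=> /andP[Aa /exists_inP[a' Aa' /andP[/eqP e1 l1]]].
  move=> /andP[Ab /exists_inP[b' Ab' /andP[/eqP e2 l2]]].
  (* The differences a' - a and b' - b lie between 0 and n, so their congruence modulo n is an
     equality, and the Sidon property modulo M - 1 applies. *)
  have E : (b' + a = a' + b)%N.
    have := mods _ _ _ _ e1 e2; have := ltn_A a'; have := ltn_A b' => b'n a'n.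
    have -> : (a + b' = (a + b) + (b' - b))%N by lia.
    have -> : (a' + b = (a + b) + (a' - a))%N by lia.
    by move/eqP; rewrite eqn_modDl !modn_small; lia.
  have [//|ab] := eqVneq a b.
  have aa' := A_sidon Aa Ab Aa' Ab' ab.
  by rewrite addnC E in aa'; move: l1; rewrite (aa' erefl) ltnn.
have gt1 : (#|Bgt| <= 1)%N.
  apply/card_le1_eqP => a b; rewrite !inE.
  move=> /andP[Aa /exists_inP[a' Aa' /andP[/eqP e1 l1]]].
  move=> /andP[Ab /exists_inP[b' Ab' /andP[/eqP e2 l2]]].
  have E : (b' + a = a' + b)%N.
    have := mods _ _ _ _ e1 e2; have := ltn_A a; have := ltn_A b => bn an.
    have -> : (a + b' = (a' + b') + (a - a'))%N by lia.
    have -> : (a' + b = (a' + b') + (b - b'))%N by lia.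
    by move/eqP; rewrite eqn_modDl !modn_small; lia.
  have [//|ab] := eqVneq a b.
  have aa' := A_sidon Aa Ab Aa' Ab' ab.
  by rewrite addnC E in aa'; move: l1; rewrite (aa' erefl) ltnn.
exact: (leq_add lt1 gt1).
Qed.

Let outside s := [set a in A | (m <= cshift s a)%N].

(* Folding the residues mod n onto residues mod M - 1 sends the elements of A
   whose shift falls in [m, n) injectively into an interval of length n - m. *)
Lemma card_outside s u : (0 < u)%N ->
  (#|outside s| ^ 2 * u <= (n - m + u) * (#|outside s| + u))%N.
Proof.
move=> u0.
(* After a wrap around, M - 1 is subtracted instead of n. As a <= M - 1 <= n, the result still lies
   in [m, n), and it is congruent to s + a modulo M - 1. *)
pose J (a : 'I_M) := if (s + a < n)%N then (s + a - m)%N else (s + a - M.-1 - m)%N.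
have mod_s (a : 'I_M) : ((s + a) %% n = if s + a < n then s + a else s + a - n)%N.
  case: ifP => h; first by rewrite modn_small.
  have sn := ltn_ord s; have an := ltn_A a.
  have {1}-> : (s + a = (s + a - n) + n)%N by lia.
  by rewrite modnDr modn_small //; lia.
have JE (a : 'I_M) : a \in outside s ->
    [/\ a \in A, (J a < n - m)%N & (J a + m = s + a %[mod M.-1])%N].
  rewrite inE val_cshift mod_s => /andP[Aa]; have a0 := A_pos Aa.
  have sn := ltn_ord s; have aM := ltn_ord a; rewrite /J; case: ifP => h1 h2.
    by split=> //; [lia|congr (_ %% _)%N; lia].
  split=> //; first by lia.
  have -> : (s + a - M.-1 - m + m = s + a - M.-1)%N by lia.
  have {2}-> : (s + a = s + a - M.-1 + M.-1)%N by lia.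
  by rewrite modnDr.
apply: (@erdos_turan _ (outside s) J) => // [a /JE[]//|].
move=> a b a' b' /JE[Aa _ ea] /JE[Ab _ eb] /JE[Aa' _ ea'] /JE[Ab' _ eb'] ab E.
apply: (A_sidon Aa Ab Aa' Ab' ab); apply/eqP.
rewrite -(eqn_modDl (s + s)).
have -> : (s + s + (a + b') = (s + a) + (s + b'))%N by lia.
have -> : (s + s + (a' + b) = (s + a') + (s + b))%N by lia.
rewrite -modnDm -ea -eb' modnDm -[X in _ == X]modnDm -ea' -eb [X in _ == X]modnDm.
by rewrite (addnACA (J a)) E (addnACA (J a')) eqxx.
Qed.

(** A point of A whose shift by s stays in the window and is hit by no other shift yields the
    coefficient [y_s], which is nonzero. Each of the other shifts spoils at most two points. *)
Lemma card_low_ge s : s \in S ->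
  (#|A| <= #|W| + 2 * (#|S| - 1) + #|outside s|)%N.
Proof.
move=> Ss; pose bad := \bigcup_(t in S :\ s) collide s t.
have bad2 : (#|bad| <= 2 * (#|S| - 1))%N.
  have -> : (#|S| - 1 = #|S :\ s|)%N by rewrite (cardsD1 s S) Ss addKn.
  rewrite mulnC -sum_nat_const /bad.
  elim/big_rec2: _ => [|t c B tS IH]; first by rewrite cards0.
  apply: (leq_trans (leq_card_setU _ _)); rewrite leq_add //.
  by apply: card_collide; move: tS; rewrite in_setD1 eq_sym => /andP[].
have good : (#|A :\: (outside s :|: bad)| <= #|W|)%N.
  rewrite -(card_imset _ (@cshift_inj s)); apply: subset_leq_card.
  apply/subsetP => i /imsetP[a]; rewrite in_setD in_setU negb_or => /andP[/andP[h1 h2] Aa] ->.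
  rewrite inE; move: h1; rewrite inE Aa /= -ltnNge => ->.
  rewrite coef_alpha_mul (bigD1 a) //= [X in _ + X]big1 ?addr0 => [|b /andP[Ab ba]].
    rewrite (bigD1 s) /=; last by rewrite val_cshift addnC.
    rewrite big1 ?addr0 => [|l /andP[/eqP e ls]]; first by move: Ss; rewrite inE.
    case/eqP: ls; apply: val_inj => /=; move: e; rewrite val_cshift (addnC s) => /eqP.
    by rewrite eqn_modDl !modn_small // => /eqP.
  apply: big1 => l /eqP e; have [//|yl] := eqVneq ((y : {poly 'F_q})`_l) 0.
  have ls : l != s.
    apply: contraNneq ba => ls; apply/eqP; apply: (@cshift_inj s).
    by apply: val_inj; rewrite -[RHS]e [LHS]val_cshift ls addnC.
  case/bigcupP: h2; exists l; first by rewrite in_setD1 ls inE.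
  rewrite inE Aa; apply/exists_inP; exists b => //.
  by apply/eqP; apply: val_inj; rewrite [RHS]val_cshift addnC e.
have : (#|A| <= #|A :\: (outside s :|: bad)| + #|outside s :|: bad|)%N.
  rewrite -(cardsID (outside s :|: bad) A) addnC leq_add2l.
  by apply: subset_leq_card; exact: subsetIr.
have := leq_of_leqif (leq_card_setU (outside s) bad).
by move=> h1 h2; lia.
Qed.

Lemma card_outside_le s : (#|outside s| <= #|A|)%N.
Proof. by apply: subset_leq_card; apply/subsetP => a; rewrite inE => /andP[]. Qed.

End Counting.

(** * Weights and distances *)

Section Distance.
Context (R : realType) (q k : nat).
Implicit Types (c : R) (f g : Fqk q k).

Lemma card_ord_sum N (p : pred nat) :
  #|[set i : 'I_N | p i]| = (\sum_(0 <= i < N) p i)%N.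
Proof. by rewrite big_mkord -sum1dep_card big_mkcond; apply: eq_bigr => i _; case: (p i). Qed.

Lemma card_ord_low N M (p : pred nat) : (M <= N)%N ->
  #|[set i : 'I_M | p i]| = #|[set i : 'I_N | (i < M)%N && p i]|.
Proof.
move=> MN; rewrite (card_ord_sum M p) (card_ord_sum N (fun i => (i < M)%N && p i)).
rewrite (big_nat_widen _ _ _ _ _ MN) big_mkcond /=; apply: eq_bigr => i _.
by case: (i < M)%N.
Qed.

Definition wt_Fqk (m : nat) f := #|[set i : 'I_m | (f : {poly 'F_q})`_i != 0]|.

Lemma wt_cyc_embed f : (0 < k)%N -> wt_cyc (embed f) = wt_Fqk k f.
Proof.
move=> k0; rewrite /wt_cyc /wt_Fqk embed_poly //.
rewrite (@card_ord_low k.+1 k (fun i => (f : {poly 'F_q})`_i != 0) (leqnSn k)).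
apply: eq_card => i; rewrite !inE; have [//|ki] := ltnP i k.
by rewrite nth_default ?eqxx // (leq_trans (size_Fqk f k0)).
Qed.

Lemma embed_eq0 f : (0 < k)%N -> embed f = 0 -> f = 0.
Proof. by move=> k0 /(congr1 val) /= e; apply: val_inj => /=; rewrite -(embed_poly f k0). Qed.

(** Coefficients of the field product are z_i - z_k. If z_k = 0 the lower bound on the weight
    applies; otherwise each zero z_i gives a nonzero coefficient, and the upper bound provides
    enough zeros. *)
Lemma codeword_weight c (m : nat) (alpha f : Fqk q k) : (0 < k)%N -> (m <= k)%N ->
  (forall y : cyc_ring q k, y != 0 -> (wt_cyc y)%:R <= c ->
     let w := #|[set i : 'I_m | (embed alpha * y : {poly 'F_q})`_i != 0]| in
     c - (wt_cyc y)%:R <= w%:R /\ w%:R <= m%:R - (c - (wt_cyc y)%:R)) ->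
  f != 0 -> c <= (wt_Fqk k f + wt_Fqk m (alpha * f))%:R.
Proof.
move=> k0 mk H f0; rewrite natrD -wt_cyc_embed //.
have [wc|/ltW cw] := lerP (wt_cyc (embed f))%:R c; last first.
  by apply: (le_trans cw); rewrite lerDl.
have e0 : embed f != 0 by apply: contraNneq f0 => /(embed_eq0 k0) ->.
have [] := H _ e0 wc; set z : {poly 'F_q} := embed alpha * embed f => h1 h2.
have coefE (i : 'I_m) : (alpha * f : {poly 'F_q})`_i = z`_i - z`_k.
  by rewrite coef_Fqk_mul // (leq_trans (ltn_ord i)).
have [zk|zk] := eqVneq z`_k 0.
  have -> : wt_Fqk m (alpha * f) = #|[set i : 'I_m | z`_i != 0]|.
    by apply: eq_card => i; rewrite !inE coefE zk subr0.
  by lra.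
pose B := [set i : 'I_m | z`_i != 0].
have le : (m - #|B| <= wt_Fqk m (alpha * f)%R)%N.
  have -> : (m - #|B| = #|~: B|)%N by rewrite [RHS]cardsCs setCK card_ord.
  apply: subset_leq_card; apply/subsetP => i; rewrite !inE negbK coefE => /eqP ->.
  by rewrite sub0r oppr_eq0.
have : (m - #|B|)%:R <= (wt_Fqk m (alpha * f))%:R :> R by rewrite ler_nat.
rewrite natrB; first by move: h2; rewrite -/B; lra.
by rewrite (leq_trans (max_card _)) // card_ord.
Qed.

(** The hypothesis [c <= n] handles the default value of the minimum. *)
Lemma min_dist_ge (F : finType) (n : nat) (C : {set 'rV[F]_n}) c : c <= n%:R ->
  (forall u v, u \in C -> v \in C -> u != v -> c <= (hamming u v)%:R) ->
  c <= (min_dist C)%:R.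
Proof.
move=> cn H; rewrite /min_dist.
apply: (big_ind (fun x : nat => c <= x%:R)) => // [x y hx hy|[u v]].
  by rewrite /minn; case: ifP.
by rewrite in_setX /= => /andP[/andP[Cu Cv] uv]; exact: H.
Qed.

(** By linearity the distance of two codewords is the weight of the codeword of f - g, split into
    its first k and its remaining m coordinates. *)
Lemma punctured_distance c (s m : nat) (alpha : Fqk q k) :
  (k + k - s = k + m)%N -> c <= k%:R ->
  (forall f, f != 0 -> c <= (wt_Fqk k f + wt_Fqk m (alpha * f))%:R) ->
  c <= (min_dist (puncture s @: code_WE alpha))%:R.
Proof.
move=> sm ck H; apply: min_dist_ge.
  by apply: (le_trans ck); rewrite ler_nat sm leq_addr.
move=> u v /imsetP[_ /imsetP[f _ ->] ->] /imsetP[_ /imsetP[g _ ->] ->] uv.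
have fg : f - g != 0 by apply: contraNneq uv => /subr0_eq ->.
apply: (le_trans (H _ fg)); rewrite ler_nat.
pose e (x : Fqk q k) (i : nat) : 'F_q :=
  if (i < k)%N then (x : {poly 'F_q})`_i else (alpha * x : {poly 'F_q})`_(i - k).
have eE x (j : 'I_(k + k)) : row_mx (Defs.coef_map x) (Defs.coef_map (alpha * x)) 0 j = e x j.
  rewrite !mxE /e; by case: splitP => i ij; rewrite mxE ij // addKn.
have -> : hamming (puncture s (row_mx (Defs.coef_map f) (Defs.coef_map (alpha * f))))
   (puncture s (row_mx (Defs.coef_map g) (Defs.coef_map (alpha * g)))) =
   #|[set i : 'I_(k + k - s) | e f i != e g i]|.
  apply: eq_card => i; rewrite !inE.
  by rewrite [X in X != _]mxE [X in _ != X]mxE !eE.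
rewrite (card_ord_sum _ (fun i => e f i != e g i)) sm.
rewrite (@big_cat_nat _ _ _ k) ?leq_addr //= leq_add //.
  rewrite /wt_Fqk (card_ord_sum _ (fun i => (f - g : {poly 'F_q})`_i != 0)).
  rewrite !big_nat; apply: leq_sum => i /andP[_ ik].
  by rewrite /e ik coefB subr_eq0.
rewrite /wt_Fqk (card_ord_sum _ (fun i => (alpha * (f - g) : {poly 'F_q})`_i != 0)).
have reindex (G : nat -> nat) :
    (\sum_(k <= i < k + m) G i = \sum_(0 <= i < m) G (i + k))%N.
  by rewrite -{1}(add0n k) big_addn addKn.
rewrite reindex; apply: leq_sum => i _.
rewrite /e ltnNge leq_addl addnK mulrBr.
by rewrite [(_ - _ : {poly _})`_i]coefB subr_eq0.
Qed.

End Distance.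

(** * Estimates for large k *)

Section Asymptotics.
Context {R : realType}.

(** The window length u is taken near eta k: large against t <= sqrt k, small against k. Then t^2 <=
    (s^2 + 2 eta)(1 + eta) k. *)
Lemma sidon_window_bound (s : R) : 0 <= s -> s < 1 -> exists k1 : nat,
  forall k t L : nat, (k1 <= k)%N -> t%:R <= Num.sqrt k%:R :> R ->
  L%:R = s ^+ 2 * k%:R + 1 ->
  (forall u : nat, (0 < u)%N -> (t ^ 2 * u <= (L + u) * (t + u))%N) ->
  t%:R <= (s + (1 - s) / 8) * Num.sqrt k%:R.
Proof.
(* 320 = 5 * 64: the loss in (s^2 + 2 eta)(1 + eta) <= s^2 + 5 eta is the square of (1 - s) / 8. *)
move=> s0 s1; pose eta := (1 - s) ^+ 2 / 320.
have e0 : 0 < eta by rewrite /eta divr_gt0 // exprn_gt0 // subr_gt0.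
have e1 : eta <= 1 / 320.
  by rewrite /eta ler_pM2r ?invr_gt0 // expr_le1 //; lra.
(* From k >= Q^2 follows sqrt k >= eta^-2, hence t <= sqrt k <= eta (eta k) <= eta u. *)
pose Q := eta^-1 ^+ 2; have i1 : 1 <= eta^-1 by rewrite invf_ge1 //; lra.
have Q0 : 0 < Q by rewrite exprn_gt0 // invr_gt0.
exists (Num.truncn (Q ^+ 2)).+1 => k t L kk tk LE H.
set K : R := k%:R in tk LE *; set w := Num.sqrt K in tk *.
have KQ : Q ^+ 2 <= K by rewrite ltW // /K (lt_le_trans (truncnS_gt _)) // ler_nat.
have K0 : 0 < K by apply: lt_le_trans KQ; rewrite exprn_gt0.
have w0 : 0 < w by rewrite sqrtr_gt0.
have ww : w * w = K by rewrite -expr2 sqr_sqrtr // ltW.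
have wQ : Q <= w.
  by rewrite -[X in X <= _]ger0_norm ?(ltW Q0) // -sqrtr_sqr ler_wsqrtr.
have ew : 1 <= eta * (eta * w).
  have : eta * (eta * Q) <= eta * (eta * w) by rewrite !ler_pM2l.
  by rewrite /Q expr2 mulVKf ?gt_eqF // mulfV ?gt_eqF.
have ew1 : 1 <= eta * w.
  apply: (le_trans ew); rewrite ler_piMl //; last by lra.
  by rewrite mulr_ge0 // ltW.
have eK : 2 <= eta * K.
  have : 1 * w <= eta * w * w by rewrite ler_pM2r.
  have : 2 <= w.
    have : eta * w <= 1 / 320 * w by rewrite ler_pM2r.
    by lra.
  by rewrite -mulrA ww; lra.
pose u := (Num.truncn (eta * K)).+1.
have u1 : eta * K < u%:R by rewrite truncnS_gt.
have u2 : u%:R <= eta * K + 1.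
  by rewrite /u -natr1 lerD2r truncn_le mulr_ge0 // ltW.
have := H u isT; rewrite -(ler_nat R) natrM natrX natrM !natrD LE.
clearbody u; set U : R := u%:R in u1 u2 *; set T : R := t%:R in tk *.
have T0 : 0 <= T by rewrite /T.
have U0 : 0 < U by lra.
move=> h.
have hu : T <= eta * U.
  have h1 : eta * (eta * K) <= eta * U by rewrite ler_pM2l // ltW.
  have h2 : 1 * w <= eta * (eta * w) * w by rewrite ler_pM2r.
  have h3 : eta * (eta * w) * w = eta * (eta * K) by rewrite -ww; ring.
  by lra.
have h1 : T ^+ 2 * U <= ((s ^+ 2 + 2 * eta) * K) * ((1 + eta) * U).
  apply: (le_trans h); apply: ler_pM; try lra.
  - by rewrite addr_ge0 ?(ltW U0) // addr_ge0 // mulr_ge0 ?sqr_ge0 // ltW.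
have h2 : T ^+ 2 <= (s ^+ 2 + 2 * eta) * (1 + eta) * K.
  by rewrite -(ler_pM2r U0); lra.
have s2 : s ^+ 2 <= 1 by rewrite expr_le1 // ltW.
have h3 : (s ^+ 2 + 2 * eta) * (1 + eta) <= (s + (1 - s) / 8) ^+ 2.
  have a1 : eta * s ^+ 2 <= eta * 1 by rewrite ler_pM2l.
  have a2 : eta * eta <= eta * 1 by rewrite ler_pM2l //; lra.
  have a3 : 5 * eta <= (1 - s) ^+ 2 / 64 by rewrite /eta; lra.
  have a4 : 0 <= s * (1 - s) by rewrite mulr_ge0 //; lra.
  by lra.
have p0 : 0 <= s + (1 - s) / 8 by lra.
have h4 : T ^+ 2 <= ((s + (1 - s) / 8) * w) ^+ 2.
  apply: (le_trans h2); rewrite exprMn [w ^+ 2]expr2 ww ler_pM2r //.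
by rewrite -(ler_pXn2r (n := 2)) // nnegrE // mulr_ge0 // ltW.
Qed.

(** As (1 - e)(1 + e/2) < 1, a prime in the short interval starting at (1 - e) sqrt k is still below
    sqrt k. *)
Lemma largest_prime_bound (e : R) : 0 < e -> e < 1 -> exists k2 : nat,
  forall k d : nat, (k2 <= k)%N ->
  (forall d', prime d' -> d'%:R < Num.sqrt (k%:R : R) -> (d' <= d)%N) ->
  (1 - e) * Num.sqrt k%:R <= d%:R.
Proof.
move=> e0 e1; have c1 : 1 < 1 + e / 2 by lra.
have [X HX] := prime_in_short_interval c1.
pose Y := Num.max X 0 / (1 - e).
exists (Num.truncn (Y ^+ 2)).+1 => k d kk dmax.
set K : R := k%:R in dmax *; set w := Num.sqrt K in dmax *.
have KY : Y ^+ 2 < K by rewrite /K (lt_le_trans (truncnS_gt _)) // ler_nat.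
have K0 : 0 < K by apply: le_lt_trans KY; rewrite sqr_ge0.
have w0 : 0 < w by rewrite sqrtr_gt0.
have Y0 : 0 <= Y by rewrite /Y divr_ge0 ?le_max ?lexx ?orbT //; lra.
have wY : Y <= w.
  by rewrite -[X in X <= _](ger0_norm Y0) -sqrtr_sqr ler_wsqrtr // ltW.
have Xx : X <= (1 - e) * w.
  have : Num.max X 0 <= w * (1 - e) by rewrite -ler_pdivrMr // subr_gt0.
  by rewrite ge_max mulrC => /andP[].
have [p pp /andP[p1 p2]] := HX _ Xx.
apply: (le_trans (ltW p1)); rewrite ler_nat; apply: dmax => //.
apply: (le_lt_trans p2); rewrite mulrA gtr_pMl //.
have : 0 < e * e by rewrite mulr_gt0.
by lra.
Qed.

End Asymptotics.

Section WeightBounds.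
Context (R : realType).

(* With t elements of the chosen shift outside the window, at least d - t
   elements lie inside, and each other term of y destroys at most two. *)
Lemma weight_bounds (s : R) (q k d m : nat) (K : finFieldType) (theta : {unit K})
    (y : cyc_ring q k) :
  0 <= s -> s < 1 -> (1 < k)%N -> prime d -> #|K| = (d ^ 2)%N ->
  generator [set: {unit K}] theta -> (d ^ 2 <= k)%N ->
  m%:R = (1 - s ^+ 2) * k%:R ->
  (1 - (1 - s) / 8) * Num.sqrt k%:R <= d%:R ->
  (forall t L : nat, t%:R <= Num.sqrt k%:R :> R -> L%:R = s ^+ 2 * k%:R + 1 ->
    (forall u : nat, (0 < u)%N -> (t ^ 2 * u <= (L + u) * (t + u))%N) ->
    t%:R <= (s + (1 - s) / 8) * Num.sqrt k%:R) ->
  let c := 1 / 4 * (1 - s) * Num.sqrt k%:R in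
  let w := #|[set i : 'I_m | (embed (alpha_star q k (bose_chowla d theta)) * y
     : {poly 'F_q})`_i != 0]| in
  y != 0 -> (wt_cyc y)%:R <= c ->
  c - (wt_cyc y)%:R <= w%:R /\ w%:R <= m%:R - (c - (wt_cyc y)%:R).
Proof.
move=> s0 s1 k1 dp cardK gen dk mE dlow window c w y0 wc.
set A := bose_chowla d theta in w *.
pose sk := Num.sqrt (k%:R : R).
have k0R : 0 < k%:R :> R by rewrite ltr0n ltnW.
have sk0 : 0 < sk by rewrite sqrtr_gt0.
have sk2 : sk * sk = k%:R by rewrite -expr2 sqr_sqrtr // ltW.
have mk : (m <= k)%N.
  rewrite -(ler_nat R) mE ler_piMl ?(ltW k0R) //.
  by have := sqr_ge0 s; lra.
have mk1 : (m <= k.+1)%N by rewrite leqW.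
have dsk : d%:R <= sk.
  rewrite -(ger0_norm (ler0n R d)) -sqrtr_sqr ler_wsqrtr // -natrX ler_nat //.
have A_pos (a : 'I_(d ^ 2)) : a \in A -> (0 < a)%N.
  by case/(bose_chowlaP dp cardK).
have A_sidon := bose_chowla_sidon dp cardK gen.
have cardA : #|A| = d by exact: card_bose_chowla.
have [i yi] : exists i : 'I_k.+1, (y : {poly 'F_q})`_i != 0.
  apply/existsP; apply: contraNT y0 => /existsPn none; apply/eqP; apply: val_inj.
  apply/polyP => i; rewrite coef0; have [ik|ik] := ltnP i k.+1.
    by have := none (Ordinal ik); rewrite negbK => /eqP.
  by rewrite nth_default // (leq_trans (size_cyc_ring y)).
pose S := [set l : 'I_k.+1 | (y : {poly 'F_q})`_l != 0].
have Si : i \in S by rewrite inE.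
have wE : w = #|[set j : 'I_k.+1 | (j < m)%N && ((embed (alpha_star q k A) * y
    : {poly 'F_q})`_j != 0)]|.
  exact: (@card_ord_low k.+1 m (fun j => (embed (alpha_star q k A) * y
    : {poly 'F_q})`_j != 0) mk1).
have up := card_low_le m A k1 dk y.
have low := card_low_ge k1 dk mk1 A_sidon Si.
have yw : wt_cyc y = #|S| by [].
rewrite -wE cardA -yw in up low.
have window_m u : (0 < u)%N -> _ := fun u0 => card_outside k1 dk mk1 A_pos A_sidon i u0.
have out_le := card_outside_le m A i.
rewrite cardA in out_le.
move: low window_m out_le; set t := #|_| => low window_m out_le.
have LE : (k.+1 - m)%:R = s ^+ 2 * k%:R + 1.
  by rewrite natrB // mE -natr1; ring.
have tsk : t%:R <= sk by apply: le_trans dsk; rewrite ler_nat.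
have tle := window t _ tsk LE window_m.
have w1 : (0 < wt_cyc y)%N by rewrite yw (cardsD1 i) Si.
have lowR : d%:R <= w%:R + 2 * ((wt_cyc y)%:R - 1) + t%:R :> R.
  by move: low; rewrite -(ler_nat R) natrD natrD natrM natrB.
have upR : w%:R <= (wt_cyc y)%:R * d%:R :> R by rewrite -natrM ler_nat.
have csk : c = 1 / 4 * ((1 - s) * sk) by rewrite /c mulrA.
have ssk0 : 0 <= (1 - s) * sk by rewrite mulr_ge0 ?(ltW sk0) // subr_ge0 ltW.
split.
  move: dlow tle; rewrite -/sk => dlow tle.
  (* Two errors (1 - s) / 8 leave d - t >= 3/4 (1 - s) sqrt k = 3 c, and 3 c - 2 wt(y) >= c - wt(y)
     because wt(y) <= c. *)
  have : 3 * c <= d%:R - t%:R by rewrite csk; lra.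
  by lra.
(* Upper bound: both the weight, at most wt(y) d <= c sqrt k, and c are at most (1 - s) k / 4, while
   m = (1 - s)(1 + s) k >= (1 - s) k. *)
have sk1 : 1 <= sk by rewrite -[X in X <= _]sqrtr1 ler_wsqrtr // ler1n ltnW.
have W0 : 0 <= (wt_cyc y)%:R :> R by [].
have h1 : (wt_cyc y)%:R * d%:R <= c * sk by apply: ler_pM.
have h2 : c * sk = 1 / 4 * ((1 - s) * k%:R) by rewrite csk -sk2; ring.
have h3 : (1 - s) * sk <= (1 - s) * k%:R.
  by rewrite ler_wpM2l -?sk2 ?ler_peMl ?(ltW sk0) // subr_ge0 ltW.
have h4 : 0 <= s * ((1 - s) * k%:R) by rewrite !mulr_ge0 // subr_ge0 ltW.
have h5 : 0 <= (1 - s) * k%:R by rewrite mulr_ge0 // subr_ge0 ltW.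
by rewrite mE; rewrite csk in h1 h2 *; lra.
Qed.

End WeightBounds.

Theorem theorem4p4 (R : realType) :
  exists2 c0 : R, 0 < c0 &
  forall (q : nat) (r : R), prime q -> 1 / 2 < r -> r < 1 ->
  exists k0 : nat,
  forall k : nat, (k0 <= k)%N ->
  prime k.+1 -> primitive_root_mod k.+1 q ->
  (r^-1 - 1) * k%:R \is a Num.int ->
  forall d : nat,
  prime d -> d%:R < Num.sqrt (k%:R : R) ->
  (forall d' : nat, prime d' -> d'%:R < Num.sqrt (k%:R : R) -> (d' <= d)%N) ->
  forall (K : finFieldType) (theta : {unit K}),
  #|K| = (d ^ 2)%N -> generator [set: {unit K}] theta ->
  let alpha : Fqk q k := alpha_star q k (bose_chowla d theta) in
  (exists2 c : R,
     c0 * (1 - Num.sqrt (2 - r^-1)) * Num.sqrt k%:R <= c &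
     forall y : cyc_ring q k, y != 0 -> (wt_cyc y)%:R <= c ->
       c - (wt_cyc y)%:R <= (wt_low r k (embed alpha * y))%:R /\
       (wt_low r k (embed alpha * y))%:R
         <= (r^-1 - 1) * k%:R - (c - (wt_cyc y)%:R))
  /\
  c0 * (1 - Num.sqrt (2 - r^-1)) * Num.sqrt k%:R
    <= (min_dist (punctured_code_WE r alpha))%:R.
Proof.
exists (1 / 4); first by lra.
move=> q r _ r12 r1.
have r0 : 0 < r by lra.
have ri1 : 1 < r^-1 by rewrite invf_gt1.
have ri2 : r^-1 < 2.
  by rewrite -(ltr_pM2r r0) mulVf ?gt_eqF //; lra.
set s := Num.sqrt (2 - r^-1).
have s2 : s ^+ 2 = 2 - r^-1 by rewrite sqr_sqrtr //; lra.
have s0 : 0 <= s by rewrite sqrtr_ge0.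
have s1 : s < 1.
  by rewrite -sqrtr1 ltr_sqrt // ; lra.
have [k1 window] := sidon_window_bound s0 s1.
have e0 : 0 < (1 - s) / 8 by lra.
have e1 : (1 - s) / 8 < 1 by lra.
have [k2 primes] := largest_prime_bound e0 e1.
exists (maxn 2 (maxn k1 k2)) => k; rewrite !geq_max => /and3P[k_gt1 kk1 kk2] _ _ int_m.
move=> d dp dlt dmax K theta cardK gen alpha.
have k0 : (0 < k)%N by exact: ltnW.
have dk : (d ^ 2 <= k)%N.
  rewrite -(ler_nat R) natrX -[X in _ <= X](sqr_sqrtr (ler0n R k)).
  by rewrite ler_pXn2r ?nnegrE ?sqrtr_ge0 // ltW.
pose m := Num.truncn ((r^-1 - 1) * k%:R).
have m_ge0 : 0 <= (r^-1 - 1) * k%:R by rewrite mulr_ge0 //; lra.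
have mE' : m%:R = (r^-1 - 1) * k%:R.
  by apply/eqP; rewrite -natrEtruncn natrEint int_m m_ge0.
have mE : m%:R = (1 - s ^+ 2) * k%:R by rewrite mE' s2; congr (_ * _); ring.
have mk : (m <= k)%N.
  by rewrite -(ler_nat R) mE' ler_piMl //; lra.
have bounds (y : cyc_ring q k) := weight_bounds (m := m) (y := y) s0 s1 k_gt1 dp cardK gen dk mE
  (primes _ _ kk2 dmax) (fun t L => window k t L kk1).
split.
  exists (1 / 4 * (1 - s) * Num.sqrt k%:R) => // y y0 wc.
  by have := bounds y y0 wc; rewrite mE'.
apply: (punctured_distance (m := m)).
(* The number of removed coordinates is k - m, which leaves length k + m. *)
- have -> : (2 - r^-1) * k%:R = (k - m)%:R :> R by rewrite natrB // mE'; ring.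
  by rewrite natrK -addnBA ?leq_subr // subKn.
- have k1R : 1 <= Num.sqrt (k%:R : R) by rewrite -[X in X <= _]sqrtr1 ler_wsqrtr // ler1n.
  rewrite -[X in _ <= X](sqr_sqrtr (ler0n R k)) expr2 ler_pM2r; lra.
move=> f f0; apply: codeword_weight => // y y0 wc; exact: bounds.
Qed.
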